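(* Let $(M,g)$ be a compact connected Riemannian manifold such that the first eigenvalue $\lambda_1$ of $-\Delta_g$ is simple. Then there is $T>0$ such that for all $t\ge T$ the heat kernel $K_t$ of $M$ is not geodesically decreasing.
   Context: Compact manifolds are without boundary and metrics are smooth. $\Delta_g$ is the Laplace-Beltrami operator; the eigenvalues of $-\Delta_g$, repeated according to multiplicity, are $0=\lambda_0<\lambda_1\le\lambda_2\le\dots$, and the first (principal) eigenvalue is $\lambda_1$. The heat kernel $K_t(x,y)$ is the fundamental solution of $\partial_t u=\Delta_g u$; equivalently $K_t(x,y)=\sum_{j\ge0}e^{-\lambda_j t}\phi_j(x)\phi_j(y)$, where $(\phi_j)$ is an $L^2(M)$-orthonormal basis of real eigenfunctions with $-\Delta_g\phi_j=\lambda_j\phi_j$. A minimal geodesic is a geodesic whose length equals the distance between its endpoints. A function $G:M\times M\to\mathbb{R}$ is geodesically decreasing if for each $x\in M$ and every minimal geodesic $\gamma:[0,s_0]\to M$ with $\gamma(0)=x$, the function $s\mapsto G(x,\gamma(s))$ is non-increasing. *)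

(* Defs.v *)
From HB Require Import structures.
From mathcomp Require Import all_boot all_order all_algebra.
From mathcomp Require Import all_classical all_reals all_analysis.

Set Implicit Arguments.
Unset Strict Implicit.
Unset Printing Implicit Defensive.

Import Order.TTheory GRing.Theory Num.Theory.
Import numFieldNormedType.Exports.

Local Open Scope classical_set_scope.
Local Open Scope ring_scope.

Definition partial (R : realType) (n : nat) (a : 'I_n) (f : 'rV[R]_n -> R)
    (x : 'rV[R]_n) : R :=
  'D_(delta_mx 0 a) f x.

(* Meant for D open, so that the partial derivatives at points of D only
   depend on f restricted to D. *)
Fixpoint Ck_on (R : realType) (n k : nat) (D : set 'rV[R]_n)
    (f : 'rV[R]_n -> R) : Prop :=
  (forall x, D x -> {for x, continuous f}) /\
  match k with
  | 0 => True
  | k'.+1 => forall a : 'I_n,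
      (forall x, D x -> derivable f x (delta_mx 0 a)) /\
      Ck_on k' D (partial a f)
  end.

Definition smooth_on (R : realType) (n : nat) (D : set 'rV[R]_n)
    (f : 'rV[R]_n -> R) : Prop :=
  forall k, Ck_on k D f.

(* Integral of a nonnegative Borel function on R^n with respect to Lebesgue
   measure, as an iterated one-dimensional integral (Tonelli). *)
Fixpoint lebesgue_int (R : realType) (n : nat) :
    ('rV[R]_n -> \bar R) -> \bar R :=
  match n with
  | 0 => fun f => f 0
  | m.+1 => fun f =>
      (\int[@lebesgue_measure R]_x
         lebesgue_int (fun v : 'rV[R]_m => f (row_mx (x%:M : 'rV[R]_1) v)))%E
  end.

(* The charts of an atlas need not form the maximal atlas.  [inv_coord i] is
   only meaningful on the image of chart [i], and [chart_at p] is an arbitrary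
   choice of a chart around [p]. *)
Record smooth_atlas (R : realType) (n : nat) (M : topologicalType) := SmoothAtlas {
  chart : Type ;
  dom : chart -> set M ;
  coord : chart -> M -> 'rV[R]_n ;
  inv_coord : chart -> 'rV[R]_n -> M ;
  chart_at : M -> chart ;
  dom_chart_at : forall p, dom (chart_at p) p ;
  dom_open : forall i, open (dom i) ;
  img_open : forall i, open (coord i @` dom i) ;
  coordK : forall i p, dom i p -> inv_coord i (coord i p) = p ;
  coord_continuous : forall i p, dom i p -> {for p, continuous (coord i)} ;
  inv_coord_continuous : forall i x,
    (coord i @` dom i) x -> {for x, continuous (inv_coord i)} ;
  transition_smooth : forall i j (b : 'I_n),
    smooth_on (coord i @` (dom i `&` dom j))
      (fun x => coord j (inv_coord i x) 0 b)
}.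

Definition img (R : realType) (n : nat) (M : topologicalType)
    (A : smooth_atlas R n M) (i : chart A) : set 'rV[R]_n :=
  coord i @` dom i.

(* Matrix of partial derivatives of the change of coordinates from chart i to
   chart j; as vectors are rows, a tangent vector v becomes v *m J. *)
Definition transition_jacobian (R : realType) (n : nat) (M : topologicalType)
    (A : smooth_atlas R n M) (i j : chart A) (x : 'rV[R]_n) : 'M[R]_n :=
  \matrix_(a, b) partial a (fun y => coord j (inv_coord i y) 0 b) x.

(* [gmx g i x] is the Gram matrix of the coordinate frame of chart i at the
   point of coordinates x. *)
Record riemannian_metric (R : realType) (n : nat) (M : topologicalType)
    (A : smooth_atlas R n M) := RiemannianMetric {
  gmx : chart A -> 'rV[R]_n -> 'M[R]_n ;
  gmx_smooth : forall i (a b : 'I_n), smooth_on (img i) (fun x => gmx i x a b) ;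
  gmx_sym : forall i x, img i x -> (gmx i x)^T = gmx i x ;
  gmx_pos : forall i x (v : 'rV[R]_n), img i x -> v != 0 ->
    0 < (v *m gmx i x *m v^T) 0 0 ;
  gmx_transition : forall i j x, (coord i @` (dom i `&` dom j)) x ->
    gmx i x = transition_jacobian i j x *m gmx j (coord j (inv_coord i x))
              *m (transition_jacobian i j x)^T
}.

Definition borel (M : ptopologicalType) := g_sigma_algebraType (@open M).

Definition is_riemannian_volume (R : realType) (n : nat) (M : ptopologicalType)
    (A : smooth_atlas R n M) (g : riemannian_metric A)
    (mu : {measure set (borel M) -> \bar R}) : Prop :=
  forall (i : chart A) (B : set (borel M)), measurable B -> B `<=` dom i ->
    mu B = lebesgue_int (fun x =>
      (\1_(coord i @` B) x * Num.sqrt (\det (gmx g i x)))%:E).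

Definition smooth_fun (R : realType) (n : nat) (M : topologicalType)
    (A : smooth_atlas R n M) (u : M -> R) : Prop :=
  forall i : chart A, smooth_on (img i) (u \o inv_coord i).

Definition laplace_beltrami (R : realType) (n : nat) (M : topologicalType)
    (A : smooth_atlas R n M) (g : riemannian_metric A) (i : chart A)
    (f : 'rV[R]_n -> R) (x : 'rV[R]_n) : R :=
  let sqrt_det y := Num.sqrt (\det (gmx g i y)) in
  (sqrt_det x)^-1 *
  \sum_(a < n) partial a (fun y =>
    sqrt_det y * \sum_(b < n) invmx (gmx g i y) a b * partial b f y) x.

(* Smooth solutions of - Delta u = a u (including 0), the equation being
   written in every chart. *)
Definition eigenspace_of (R : realType) (n : nat) (M : topologicalType)
    (A : smooth_atlas R n M) (g : riemannian_metric A) (a : R) : set (M -> R) :=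
  [set u | smooth_fun A u /\
    forall (i : chart A) x, img i x ->
      - laplace_beltrami g i (u \o inv_coord i) x = a * u (inv_coord i x)].

Definition simple_eigenvalue (R : realType) (n : nat) (M : topologicalType)
    (A : smooth_atlas R n M) (g : riemannian_metric A) (a : R) : Prop :=
  exists u : M -> R,
    [/\ eigenspace_of g a u, exists p, u p != 0 &
        forall v, eigenspace_of g a v -> exists c : R, forall p, v p = c * u p].

Definition inner (R : realType) (M : ptopologicalType)
    (mu : {measure set (borel M) -> \bar R}) (u v : M -> R) : R :=
  (\int[mu]_(p in [set: borel M]) (u p * v p))%R.

Definition L2_orthonormal_basis (R : realType) (M : ptopologicalType)
    (mu : {measure set (borel M) -> \bar R}) (phi : nat -> M -> R) : Prop :=
  [/\ forall j, (phi j : borel M -> R) \in Lfun mu 2%:E,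
      forall j k, inner mu (phi j) (phi k) = (j == k)%:R &
      forall u : borel M -> R, u \in Lfun mu 2%:E ->
        (fun N => Lnorm mu 2%:E (fun p : borel M =>
           (u p - \sum_(j < N) inner mu u (phi j) * phi j p)%:E))
          @ \oo --> 0%E].

(* lam lists the eigenvalues of - Delta with multiplicity, in increasing order
   and starting at lam 0 = 0; phi is an associated L^2-orthonormal basis of
   real eigenfunctions. *)
Definition spectral_resolution (R : realType) (n : nat) (M : ptopologicalType)
    (A : smooth_atlas R n M) (g : riemannian_metric A)
    (mu : {measure set (borel M) -> \bar R})
    (lam : nat -> R) (phi : nat -> M -> R) : Prop :=
  [/\ lam 0%N = 0, 0 < lam 1%N,
      (forall j k, (j <= k)%N -> lam j <= lam k),
      (forall j, eigenspace_of g (lam j) (phi j)) &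
      L2_orthonormal_basis mu phi].

(* The eigenfunction expansion of the heat kernel, including its pointwise
   convergence. *)
Definition is_heat_kernel (R : realType) (M : Type)
    (lam : nat -> R) (phi : nat -> M -> R) (K : R -> M -> M -> R) : Prop :=
  forall t x y, 0 < t ->
    (fun N => \sum_(j < N) expR (- lam j * t) * phi j x * phi j y)
      @ \oo --> K t x y.

Definition speed (R : realType) (n : nat) (M : topologicalType)
    (A : smooth_atlas R n M) (g : riemannian_metric A)
    (gam : R -> M) (s : R) : R :=
  let i := chart_at A (gam s) in
  let v := derive1 (coord i \o gam) s in
  Num.sqrt ((v *m gmx g i (coord i (gam s)) *m v^T) 0 0).

Definition curve_length (R : realType) (n : nat) (M : topologicalType)
    (A : smooth_atlas R n M) (g : riemannian_metric A)
    (gam : R -> M) (a b : R) : R :=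
  (\int[@lebesgue_measure R]_(s in `[a, b]) speed g gam s)%R.

(* Curves on [a, b] are restrictions of total functions; regularity is asked on
   a neighbourhood of [a, b], i.e. the curve extends regularly past its ends. *)
Definition C1_curve (R : realType) (n : nat) (M : topologicalType)
    (A : smooth_atlas R n M) (gam : R -> M) (a b : R) : Prop :=
  exists2 e : R, 0 < e & forall s, a - e < s < b + e ->
    {for s, continuous gam} /\
    forall i : chart A, dom i (gam s) ->
      derivable (coord i \o gam) s 1 /\
      {for s, continuous (derive1 (coord i \o gam))}.

(* [path_length g x y l]: l is the length of a piecewise C^1 curve from x to y,
   i.e. of a finite concatenation of C^1 curves. *)
Inductive path_length (R : realType) (n : nat) (M : topologicalType)
    (A : smooth_atlas R n M) (g : riemannian_metric A) : M -> M -> R -> Prop :=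
| path_length_C1 (gam : R -> M) (a b : R) : a <= b -> C1_curve A gam a b ->
    path_length g (gam a) (gam b) (curve_length g gam a b)
| path_length_cat (x y z : M) (l m : R) :
    path_length g x y l -> path_length g y z m -> path_length g x z (l + m).

Definition riemannian_dist (R : realType) (n : nat) (M : topologicalType)
    (A : smooth_atlas R n M) (g : riemannian_metric A) (x y : M) : R :=
  inf [set l | path_length g x y l].

Definition christoffel (R : realType) (n : nat) (M : topologicalType)
    (A : smooth_atlas R n M) (g : riemannian_metric A) (i : chart A)
    (k a b : 'I_n) (x : 'rV[R]_n) : R :=
  2^-1 * \sum_(l < n) invmx (gmx g i x) k l *
    (partial a (fun y => gmx g i y l b) x +
     partial b (fun y => gmx g i y l a) x -
     partial l (fun y => gmx g i y a b) x).

(* Affinely parametrized; smoothness of the coordinates of gam follows from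
   the equation. *)
Definition is_geodesic (R : realType) (n : nat) (M : topologicalType)
    (A : smooth_atlas R n M) (g : riemannian_metric A)
    (gam : R -> M) (a b : R) : Prop :=
  exists2 e : R, 0 < e & forall s, a - e < s < b + e ->
    {for s, continuous gam} /\
    forall i : chart A, dom i (gam s) ->
      let c := coord i \o gam in
      [/\ derivable c s 1, derivable (derive1 c) s 1 &
          forall k : 'I_n,
            derive1 (derive1 c) s 0 k +
            \sum_(p < n) \sum_(q < n)
              christoffel g i k p q (c s) * derive1 c s 0 p * derive1 c s 0 q = 0].

Definition minimal_geodesic (R : realType) (n : nat) (M : topologicalType)
    (A : smooth_atlas R n M) (g : riemannian_metric A)
    (gam : R -> M) (s0 : R) : Prop :=
  [/\ 0 <= s0, is_geodesic g gam 0 s0 &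
      curve_length g gam 0 s0 = riemannian_dist g (gam 0) (gam s0)].

Definition geodesically_decreasing (R : realType) (n : nat)
    (M : topologicalType) (A : smooth_atlas R n M) (g : riemannian_metric A)
    (G : M -> M -> R) : Prop :=
  forall (x : M) (gam : R -> M) (s0 : R),
    minimal_geodesic g gam s0 -> gam 0 = x ->
    forall s r : R, 0 <= s -> s <= r -> r <= s0 ->
      G x (gam r) <= G x (gam s).

(* Main.v *)
Require Import Defs.
From mathcomp Require Import all_boot all_order all_algebra.
From mathcomp Require Import all_classical all_reals all_analysis.
From HB Require Import structures.
From mathcomp Require Import ring lra.
(* Again, because vector.v also defines [coord]. *)
Import Defs.
Import Order.TTheory GRing.Theory Num.Theory.
Import numFieldNormedType.Exports.
Local Open Scope classical_set_scope.
Local Open Scope ring_scope.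

Set Implicit Arguments.
Unset Strict Implicit.
Unset Printing Implicit Defensive.

(* If [K_t] is geodesically decreasing for arbitrarily large [t], then the
   leading terms of the eigenfunction expansion inherit the property: letting
   [t] tend to infinity, [phi_0(x) phi_0(gam s)] is non-increasing along minimal
   geodesics issued from [x], which forces [phi_0] to be constant; after
   subtracting that term and multiplying by [exp(lam_1 t)], simplicity of
   [lam_1] gives the same for [phi_1], which contradicts [lam_1 > 0].

   A smooth [u] such that [u(x) u(gam s)] is non-increasing is constant: short
   geodesics are minimal in every direction, so the differential of [u] vanishes
   wherever [u] does not, and the nonzero level sets of [u] are open and closed.

   Existence of geodesics is Picard iteration.  Short geodesics are shown to be
   minimal without exponential map: in a chart, with [p] the momentum of the
   geodesic [c] and [k] large, the function
   [F(t, z) = p(t).(z - c(t)) - (k t / 2) |z - c(t)|^2] satisfies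
   [dF/dt |u| + dF/dz.u <= 0] near the base point, where [|u|] is the Riemannian
   norm of the velocity [u].  Hence [F] (arc length, position) decreases along
   every curve, while [F(., c(s))] is strictly decreasing and vanishes at [s],
   which excludes a path from [c(0)] to [c(s)] of length less than [s]. *)

(** * Calculus in R^n *)

(** The usual calibration is the distance from the base point, whose smoothness rests on the
    dependence of geodesics on their initial velocity. Here it is replaced by a subsolution that
    touches along a single geodesic. At z = c(t) the time derivative of F is -1 and its differential
    is a unit covector, so the inequality is an equality there for u = c'(t). The geodesic equation,
    read as (momentum)' = gradient of the kinetic energy, makes it hold to first order in z - c(t).
    The quadratic error is paid for by the time derivative -(k/2)|z - c|^2 of the concave term; its
    factor t keeps the contribution k t to the differential below 1 for short times, so k can be
    fixed before the time interval, without circularity. The inequality is first proved with (|u|^2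
    - 1)/2 on the right, then made homogeneous by scaling u. Geodesics must satisfy their equation
    in all charts, and [speed] uses an arbitrary chart at each point: hence the transformation
    rules. The Laplacian enters only through its vanishing on constants; constancy of phi_0, too, is
    read off from the kernel. *)

Section real_line.
Variable R : realType.
Implicit Types (f : R -> R) (a b e : R).

Lemma is_derive1_continuous (V : normedModType R) (f : R -> V) (x : R) (d : V) :
  is_derive x 1 f d -> {for x, continuous f}.
Proof. by move=> [df _]; apply/differentiable_continuous/derivable1_diffP. Qed.

Lemma MVT_le f (df : R -> R) a b : a <= b ->
  (forall x, a <= x <= b -> is_derive x 1 f (df x)) ->
  exists2 c, a <= c <= b & f b - f a = df c * (b - a).
Proof.
move=> ab fd.
have [||c cab E] := @MVT_segment R f df a b ab.
- by move=> x /[!in_itv]/= /andP[ax xb]; apply: fd; rewrite !ltW.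
- apply: derivable_within_continuous => x /[!in_itv]/= xab.
  by have [] := fd x xab.
- by exists c => //; move: cab; rewrite in_itv.
Qed.

Lemma nonincreasing_derive f (df : R -> R) a b : a <= b ->
  (forall x, a <= x <= b -> is_derive x 1 f (df x)) ->
  (forall x, a <= x <= b -> df x <= 0) -> f b <= f a.
Proof.
move=> ab fd df0; have [c cab E] := MVT_le ab fd.
by rewrite -subr_le0 E mulr_le0_ge0 ?df0// subr_ge0.
Qed.

Lemma dist_le_derive f (df : R -> R) a b e :
  (forall x, Num.min a b <= x <= Num.max a b -> is_derive x 1 f (df x)) ->
  (forall x, Num.min a b <= x <= Num.max a b -> `|df x| <= e) ->
  `|f b - f a| <= e * `|b - a|.
Proof.
wlog ab : a b / a <= b => [th|] fd df0.
  case: (leP a b) => [ab|/ltW ab]; first exact: th.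
  rewrite distrC [X in _ <= _ * X]distrC.
  by apply: th => // x; rewrite minC maxC; [apply: fd|apply: df0].
have [|c cab ->] := @MVT_le f df a b ab.
  by move=> x xab; apply: fd; rewrite min_l// max_r.
by rewrite normrM ler_wpM2r// df0// min_l// max_r.
Qed.

End real_line.

Lemma cvg_sumr (R : realType) (T I : Type) (F : set_system T) (r : seq I)
    (f : I -> T -> R) (l : I -> R) : Filter F ->
  (forall i, f i x @[x --> F] --> l i) ->
  \sum_(i <- r) f i x @[x --> F] --> \sum_(i <- r) l i.
Proof. by move=> FF fl; apply: cvg_big => //; exact: add_continuous. Qed.

Section row_vectors.
Variables (R : realType) (n : nat).
Implicit Types (x y z w v : 'rV[R]_n) (a b : 'I_n) (f : 'rV[R]_n -> R).

Lemma coord_le_norm x a : `|x 0 a| <= `|x|.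
Proof.
rewrite [leRHS]/Num.Def.normr/= mx_normrE.
exact: (le_bigmax _ (fun ij : 'I_1 * 'I_n => `|x ij.1 ij.2|) (0, a)).
Qed.

Lemma rV_norm_le x (e : R) : 0 <= e -> (forall a, `|x 0 a| <= e) -> `|x| <= e.
Proof.
move=> e0 xe; rewrite [leLHS]/Num.Def.normr/= mx_normrE.
by apply: bigmax_le => // -[i j] _ /=; rewrite ord1.
Qed.

Lemma is_derive_along f (v w : 'rV[R]_n) (t : R) :
  derivable f (w + t *: v) v ->
  is_derive t 1 (fun h : R => f (w + h *: v)) ('D_v f (w + t *: v)).
Proof.
move=> fd.
have E : (fun h : R => h^-1 *: (f (w + (h%:A + t) *: v) - f (w + t *: v))) =
         (fun h : R => h^-1 *: (f (h *: v + (w + t *: v)) - f (w + t *: v))).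
  apply/funext => h; congr (_ *: (f _ - _)).
  by rewrite scalerDl -[h%:A]/(h * 1) mulr1 addrCA.
by split; rewrite ?/derivable /derive /= ?E.
Qed.


(** The coordinate box spanned by two points. It plays the role of the segment: paths parallel to
    the axes stay in it, and so does every ball of the sup norm that contains both points. *)
Definition between x y w :=
  forall a, Num.min (x 0 a) (y 0 a) <= w 0 a <= Num.max (x 0 a) (y 0 a).

Let mix (k : nat) x y : 'rV[R]_n :=
  \row_a (if (a < k)%N then y 0 a else x 0 a).

Let mixS (k : nat) (x y : 'rV[R]_n) (a : 'I_n) : a = k :> nat ->
  mix k.+1 x y = mix k x y + (y 0 a - x 0 a) *: delta_mx 0 a.
Proof.
move=> ak; apply/rowP => b; rewrite !mxE eqxx/= ltnS leq_eqVlt -ak.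
have [->|ba] := eqVneq b a; first by rewrite !eqxx ltnn/= mulr1 addrC subrK.
by rewrite mulr0 addr0 -val_eqE/= in ba *; rewrite (negbTE ba).
Qed.

(* Joins the two points by a path made of segments parallel to the axes. *)
Lemma dist_le_partial f x y (e : R) :
  (forall w a, between x y w ->
    derivable f w (delta_mx 0 a) /\ `|partial a f w| <= e) ->
  `|f y - f x| <= e * \sum_a `|y 0 a - x 0 a|.
Proof.
move=> fe.
suff H k : (k <= n)%N ->
    `|f (mix k x y) - f x| <= e * \sum_(a < n | (a < k)%N) `|y 0 a - x 0 a|.
  have := H n (leqnn n); rewrite (_ : mix n x y = y).
    by rewrite (eq_bigl xpredT) // => a; rewrite ltn_ord.
  by apply/rowP => a; rewrite mxE ltn_ord.
elim: k => [|k ih] kn.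
  rewrite (_ : mix 0 x y = x) ?subrr ?normr0 ?big_pred0 ?mulr0//.
  by apply/rowP => a; rewrite mxE.
pose a := Ordinal kn.
rewrite (bigD1 a)//= mulrDr.
rewrite (eq_bigl (fun i : 'I_n => (i < k)%N)); last first.
  move=> i; rewrite -val_eqE/= ltnS leq_eqVlt.
  by case: ltngtP.
rewrite -(subrKA (f (mix k x y))) (le_trans (ler_normD _ _))// lerD ?ih// ?(ltnW kn)//.
pose h (t : R) := f (mix k x y + t *: delta_mx 0 a).
have -> : f (mix k x y) = h 0 by rewrite /h scale0r addr0.
rewrite (mixS x y (a := a))//.
rewrite -/(h _) -[X in _ <= _ * `|X|]subr0.
have bt t : Num.min 0 (y 0 a - x 0 a) <= t <= Num.max 0 (y 0 a - x 0 a) ->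
    between x y (mix k x y + t *: delta_mx 0 a).
  move=> ht b; rewrite !mxE eqxx/=.
  have [->|ba] := eqVneq b a.
    rewrite ltnn mulr1.
    move: ht; case: (leP 0 (y 0 a - x 0 a)) => ?;
      case: (leP (x 0 a) (y 0 a)) => ? /andP[? ?]; apply/andP; split; lra.
  by rewrite mulr0 addr0; case: ifP => _; rewrite ?ge_min ?le_max ?lexx ?orbT.
apply: (dist_le_derive (df := fun t => partial a f (mix k x y + t *: delta_mx 0 a))) => t ht.
- apply: is_derive_along.
  by have [] := fe _ a (bt _ ht).
- by have [] := fe _ a (bt _ ht).
Qed.

Lemma sum_coord_le_norm x : \sum_a `|x 0 a| <= n%:R * `|x|.
Proof.
rewrite (le_trans (ler_sum _ (fun a _ => coord_le_norm x a)))//.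
by rewrite sumr_const card_ord mulr_natl.
Qed.

Lemma between_ball (c x y w : 'rV[R]_n) (r : R) :
  `|x - c| < r -> `|y - c| < r -> between x y w -> `|w - c| < r.
Proof.
move=> xr yr bw.
have r0 : 0 < r by rewrite (le_lt_trans _ xr).
pose m := Num.max `|x - c| `|y - c|.
apply: (@le_lt_trans _ _ m); last by rewrite gt_max xr.
apply: rV_norm_le => [|a]; first by rewrite le_max normr_ge0.
have xm : `|x 0 a - c 0 a| <= m.
  by rewrite le_max; have := coord_le_norm (x - c) a; rewrite !mxE => ->.
have ym : `|y 0 a - c 0 a| <= m.
  by rewrite le_max; have := coord_le_norm (y - c) a; rewrite !mxE => ->; rewrite orbT.
move: xm ym (bw a); rewrite !mxE !ler_norml.
by case: (leP (x 0 a) (y 0 a)) => _ /andP[? ?] /andP[? ?] /andP[? ?]; apply/andP; split; lra.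
Qed.

Lemma between_norm (x y w : 'rV[R]_n) : between x y w -> `|w - x| <= `|y - x|.
Proof.
move=> bw; apply: rV_norm_le => // a.
apply: le_trans (coord_le_norm (y - x) a); rewrite !mxE.
move: (bw a); case: (leP (x 0 a) (y 0 a)) => xy /andP[? ?].
  by rewrite (ger0_norm (x := y 0 a - _)) ?subr_ge0// ler_norml; apply/andP; split; lra.
by rewrite (ltr0_norm (x := y 0 a - _)) ?subr_lt0// ler_norml; apply/andP; split; lra.
Qed.

End row_vectors.

Lemma is_diff_expansion (R : numFieldType) (V W : normedModType R) (f : V -> W)
    (df : {linear V -> W}) (x : V) : continuous df ->
  (forall e : R, 0 < e -> \forall h \near 0, `|f (h + x) - (f x + df h)| <= e * `|h|) ->
  is_diff x f df.
Proof.
move=> cdf fe.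
have E : f \o shift x = cst (f x) + df +o_ 0 id.
  by apply/eqaddoP => e e0; exact: fe.
have dE := diff_unique cdf E.
by split=> //; apply/diff_locallyP; rewrite dE.
Qed.

Lemma is_derive_line (R : numFieldType) (V W : normedModType R) (f : V -> W)
    (x v : V) (d : W) :
  is_derive x v f d <-> is_derive (0 : R) 1 (fun h => f (h *: v + x)) d.
Proof.
have E : (fun h : R => h^-1 *: (f ((h *: (1 : R) + 0 : R) *: v + x) - f ((0 : R) *: v + x))) =
         (fun h : R => h^-1 *: (f (h *: v + x) - f x)).
  by apply/funext => h; rewrite addr0 -[h *: 1]/(h * 1) mulr1 scale0r add0r.
by split=> -[]; rewrite /derivable /derive /= ?E => ? ?;
  split; rewrite /derivable /derive /= ?E.
Qed.

(** Since [c] is derivable in the direction [v] only, it is first restricted to the line through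
    [s], where derivable and differentiable agree. *)
Lemma is_derive_diff_comp (R : numFieldType) (U V W : normedModType R)
    (c : U -> V) (f : V -> W) (df : V -> W) (s v : U) (c' : V) :
  is_derive s v c c' -> is_diff (c s) f df -> is_derive s v (f \o c) (df c').
Proof.
move=> /is_derive_line [/derivable1_diffP cd cE] fd.
set g := fun h : R => c (h *: v + s) in cd cE.
have g0 : g 0 = c s by rewrite /g scale0r add0r.
rewrite -g0 in fd; apply/is_derive_line.
have [fgd fgE] := is_diff_comp (differentiableP cd) fd.
split; first exact/derivable1_diffP.
by rewrite (deriveE _ fgd) fgE /= -cE (deriveE _ cd).
Qed.

Section C1_functions.
Variables (R : realType) (n : nat).
Implicit Types (x y z w v : 'rV[R]_n) (a b : 'I_n) (f : 'rV[R]_n -> R).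
Implicit Types (D : set 'rV[R]_n).

Lemma is_derive_coord (V : normedModType R) (c : V -> 'rV[R]_n) (s v : V) (c' : 'rV[R]_n) a :
  is_derive s v c c' -> is_derive s v (fun t => c t 0 a) (c' 0 a).
Proof.
move=> [cd <-]; split; first exact: (derivable_mxP _ _ _).1.
by rewrite (derive_mx cd) mxE.
Qed.

Lemma is_derive_rV (V : normedModType R) (c : V -> 'rV[R]_n) (s v : V) (c' : 'rV[R]_n) :
  (forall a, is_derive s v (fun t => c t 0 a) (c' 0 a)) -> is_derive s v c c'.
Proof.
move=> cd; have cdv : derivable c s v.
  by apply/derivable_mxP => i a; rewrite ord1; have [] := cd a.
split=> //; rewrite (derive_mx cdv); apply/rowP => a; rewrite mxE.
by have [] := cd a.
Qed.

(** Mean value inequality for [f] minus the linear form [k]. With [k] the gradient at one end it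
    gives a first-order expansion, and a quadratic remainder when the partial derivatives are
    Lipschitz. *)
Lemma expansion_le f x y (k : 'I_n -> R) (e : R) :
  (forall w a, between x y w ->
    derivable f w (delta_mx 0 a) /\ `|partial a f w - k a| <= e) -> 0 <= e ->
  `|f y - f x - \sum_a k a * (y 0 a - x 0 a)| <= e * (n%:R * `|y - x|).
Proof.
move=> fe e0.
pose h z := f z - \sum_a k a * z 0 a.
have -> : f y - f x - \sum_a k a * (y 0 a - x 0 a) = h y - h x.
  rewrite /h -!addrA; congr (_ + _).
  under eq_bigr do rewrite mulrBr.
  by rewrite sumrB; ring.
have hd w a : between x y w -> is_derive w (delta_mx 0 a) h (partial a f w - k a).
  move=> bw; have [fd _] := fe w a bw.
  apply: is_deriveB; first exact/derivableP/fd.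
  rewrite (_ : (fun z => _) = \sum_b (fun z : 'rV[R]_n => k b * z 0 b)); last first.
    by apply/funext => z; rewrite fct_sumE.
  rewrite [X in is_derive _ _ _ X](_ : _ = \sum_b k b *: (delta_mx 0 a : 'rV[R]_n) 0 b).
    apply: is_derive_sum => b; apply: is_deriveZ.
    by apply: (@is_derive_coord _ id).
  rewrite (bigD1 a)//= mxE !eqxx /= [_ *: _]mulr1 big1 ?addr0// => b ba.
  by rewrite mxE (negbTE ba) andbF scaler0.
apply: (le_trans (@dist_le_partial _ _ h x y e _)) => [w a bw|].
  have [hd1 hd2] := hd w a bw; split => //.
  by rewrite /partial hd2; have [] := fe w a bw.
rewrite ler_wpM2l//.
by have := sum_coord_le_norm (y - x); under eq_bigr do rewrite !mxE.
Qed.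

Lemma C1_expansion D f x (e : R) : open D -> D x -> Ck_on 1 D f -> 0 < e ->
  \forall y \near x,
    `|f y - f x - \sum_a partial a f x * (y 0 a - x 0 a)| <= e * `|y - x|.
Proof.
move=> oD Dx [_ fa] e0.
(* The sum over coordinates costs a factor n; dividing by n + 1 also covers dimension 0. *)
pose e1 := e / n.+1%:R.
have e10 : 0 < e1 by rewrite divr_gt0.
have : \forall y \near x, D y /\ forall a, `|partial a f x - partial a f y| < e1.
  have H : \forall y \near x, forall a, `|partial a f x - partial a f y| < e1.
    apply: (@filter_forall _ _ (fun a y => `|partial a f x - partial a f y| < e1)
      _ (nbhs_filter x)).
    move=> a; have [_ [/(_ x Dx) + _]] := fa a.
    by move=> /cvgrPdist_lt; apply.
  by near=> y; split; near: y => //; apply: open_nbhs_nbhs.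
move=> /nbhs_normP[r /= r0 rD].
apply/nbhs_normP; exists r => //= y xy.
apply: (le_trans (@expansion_le f x y (fun a => partial a f x) e1 _ _)); last 2 first.
- exact: ltW.
- rewrite /e1 mulrAC ler_pdivrMr// -mulrA ler_pM2l// mulrC.
  by rewrite mulrC [leRHS]mulrC ler_wpM2r// ler_nat.
move=> w a bw; have [fd _] := fa a.
have /rD[Dw wx] : ball_ Num.norm x r w.
  rewrite /ball_/= distrC; apply: between_ball bw; first by rewrite subrr normr0.
  by rewrite distrC.
by split; [exact: fd|rewrite distrC ltW].
Unshelve. all: by end_near. Qed.

Lemma C1_is_diff D f x : open D -> D x -> Ck_on 1 D f ->
  is_diff x f (fun v => \sum_a partial a f x * v 0 a).
Proof.
move=> oD Dx f1.
pose df v := \sum_a partial a f x * v 0 a.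
have lin : linear df.
  move=> k u v; rewrite /df scaler_sumr -big_split/=; apply: eq_bigr => a _.
  by rewrite !mxE mulrDr -[k *: _]/(k * _) !mulrA (mulrC k).
pose L := GRing.isLinear.Build _ _ _ _ _ lin.
pose dfl : {linear _ -> _} := HB.pack df L.
have cdf : continuous dfl.
  move=> z; apply: (@cvg_sumr _ _ _ _ _ _ _ (nbhs_filter z)) => a.
  by apply: cvgMr; exact: matrix_normedtype.coord_continuous.
apply: (@is_diff_expansion _ _ _ f dfl) => // e e0.
have := C1_expansion oD Dx f1 e0; rewrite (near_shift 0)/= => H.
apply: filterS H => h /=; rewrite subr0 addrK.
rewrite opprD addrA /df.
by under eq_bigr do rewrite mxE addrK.
Qed.

Lemma C1_chain D f (V : normedModType R) (c : V -> 'rV[R]_n) (s v : V) (c' : 'rV[R]_n) :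
  open D -> D (c s) -> Ck_on 1 D f -> is_derive s v c c' ->
  is_derive s v (f \o c) (\sum_a partial a f (c s) * c' 0 a).
Proof.
by move=> oD Dx f1 cd; apply: is_derive_diff_comp cd (C1_is_diff oD Dx f1).
Qed.

End C1_functions.

(** * Locally Lipschitz functions *)

Section locally_lipschitz.
Variables (R : realType) (V : normedModType R).
Implicit Types (f g : V -> R) (x : V).

(** The regularity consumed by Picard iteration. Its stability under sums, products and inverses
    reaches the geodesic field without differentiating that field. *)
Definition lip_near f x := exists2 k : R, 0 <= k &
  exists2 r : R, 0 < r & forall y z, `|y - x| < r -> `|z - x| < r ->
    `|f z - f y| <= k * `|z - y|.

Lemma lip_near_family (I : finType) (F : I -> V -> R) x :
  (forall i, lip_near (F i) x) -> exists2 k : R, 0 <= k &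
  exists2 r : R, 0 < r & forall i y z, `|y - x| < r -> `|z - x| < r ->
    `|F i z - F i y| <= k * `|z - y|.
Proof.
move=> Fl.
have /choice[kr Hkr] i : exists kr : R * R, [/\ 0 <= kr.1, 0 < kr.2 &
    forall y z, `|y - x| < kr.2 -> `|z - x| < kr.2 ->
    `|F i z - F i y| <= kr.1 * `|z - y|].
  by have [k k0 [r r0 H]] := Fl i; exists (k, r).
exists (\sum_i (kr i).1); first by apply: sumr_ge0 => i _; have [] := Hkr i.
exists (\big[Num.min/1]_i (kr i).2).
  by apply/bigmin_gtP; split => // i _; have [] := Hkr i.
move=> i y z yr zr; have [k0 r0 H] := Hkr i.
have le : \big[Num.min/1]_i (kr i).2 <= (kr i).2 by exact: bigmin_le.
apply: (le_trans (H _ _ (lt_le_trans yr le) (lt_le_trans zr le))).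
rewrite ler_wpM2r// (bigD1 i)//= lerDl sumr_ge0// => j _.
by have [] := Hkr j.
Qed.

Lemma lip_near_cst (c : R) x : lip_near (fun=> c) x.
Proof. by exists 0 => //; exists 1 => // y z _ _; rewrite subrr normr0 mul0r. Qed.

Lemma lip_nearD f g x : lip_near f x -> lip_near g x ->
  lip_near (fun y => f y + g y) x.
Proof.
move=> [k k0 [r r0 fk]] [l l0 [s s0 gl]]; exists (k + l); first exact: addr_ge0.
exists (Num.min r s); first by rewrite lt_min r0.
move=> y z; rewrite !lt_min => /andP[yr ys] /andP[zr zs].
rewrite opprD addrACA (le_trans (ler_normD _ _))// mulrDl.
by rewrite lerD ?fk ?gl.
Qed.

Lemma lip_near_bounded f x : lip_near f x -> exists2 b : R, 0 <= b &
  exists2 r : R, 0 < r & forall y, `|y - x| < r -> `|f y| <= b.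
Proof.
move=> [k k0 [r r0 fk]]; exists (`|f x| + k * r).
  by rewrite addr_ge0// mulr_ge0// ltW.
exists r => // y yr; rewrite -(subrK (f x) (f y)) addrC.
rewrite (le_trans (ler_normD _ _))// lerD2l.
rewrite (le_trans (fk _ _ _ yr))//; first by rewrite subrr normr0.
by rewrite ler_wpM2l// ltW.
Qed.

Lemma lip_nearM f g x : lip_near f x -> lip_near g x ->
  lip_near (fun y => f y * g y) x.
Proof.
move=> fl gl.
have [b b0 [rb rb0 fb]] := lip_near_bounded fl.
have [c c0 [rc rc0 gc]] := lip_near_bounded gl.
move: fl gl => [k k0 [r r0 fk]] [l l0 [s s0 gl]].
exists (b * l + k * c); first by rewrite addr_ge0// mulr_ge0.
exists (Num.min (Num.min r s) (Num.min rb rc)); first by rewrite !lt_min r0 s0 rb0.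
move=> y z; rewrite !lt_min => /andP[/andP[yr ys] /andP[yb yc]].
move=> /andP[/andP[zr zs] /andP[zb zc]].
have -> : f z * g z - f y * g y = f z * (g z - g y) + (f z - f y) * g y by ring.
rewrite (le_trans (ler_normD _ _))// !normrM mulrDl lerD//.
  by rewrite -mulrA ler_pM ?fb ?gl.
by rewrite mulrAC ler_pM ?gc ?fk.
Qed.

Lemma lip_near_sum (I : Type) (s : seq I) (P : pred I) (F : I -> V -> R) x :
  (forall i, P i -> lip_near (F i) x) ->
  lip_near (fun y => \sum_(i <- s | P i) F i y) x.
Proof.
move=> Fl; elim: s => [|i s ih].
  rewrite (_ : (fun=> _) = fun=> 0) ?funeqE; [exact: lip_near_cst|by move=> y; rewrite big_nil].
have [Pi|nPi] := boolP (P i); last first.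
  by move: ih; congr lip_near; apply/funext => y; rewrite big_cons (negbTE nPi).
rewrite (_ : (fun=> _) = fun y => F i y + \sum_(i <- s | P i) F i y); last first.
  by apply/funext => y; rewrite big_cons Pi.
by apply: lip_nearD; [exact: Fl|].
Qed.

Lemma lip_near_prod (I : Type) (s : seq I) (P : pred I) (F : I -> V -> R) x :
  (forall i, P i -> lip_near (F i) x) ->
  lip_near (fun y => \prod_(i <- s | P i) F i y) x.
Proof.
move=> Fl; elim: s => [|i s ih].
  rewrite (_ : (fun=> _) = fun=> 1) ?funeqE; [exact: lip_near_cst|by move=> y; rewrite big_nil].
have [Pi|nPi] := boolP (P i); last first.
  by move: ih; congr lip_near; apply/funext => y; rewrite big_cons (negbTE nPi).
rewrite (_ : (fun=> _) = fun y => F i y * \prod_(i <- s | P i) F i y); last first.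
  by apply/funext => y; rewrite big_cons Pi.
by apply: lip_nearM; [exact: Fl|].
Qed.

Lemma lip_nearV f x : lip_near f x -> f x != 0 -> lip_near (fun y => (f y)^-1) x.
Proof.
move=> [k k0 [r r0 fk]] fx0.
pose m := `|f x| / 2.
have m0 : 0 < m by rewrite divr_gt0// normr_gt0.
(* Within this radius [f] varies by at most half of [|f x|], hence stays at least [m] in absolute
   value. *)
pose s := Num.min r (m / (k + 1)).
have k10 : 0 < k + 1 by rewrite ltr_wpDl.
have fm y : `|y - x| < s -> m <= `|f y|.
  rewrite lt_min => /andP[yr ym].
  have : `|f x - f y| <= m.
    apply: (le_trans (fk _ _ yr _)); first by rewrite subrr normr0.
    rewrite distrC (@le_trans _ _ ((k + 1) * `|y - x|))//.
      by rewrite ler_wpM2r// lerDl.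
    by rewrite mulrC -ler_pdivlMr// ltW.
  have := ler_normD (f x - f y) (f y); rewrite subrK /m; lra.
exists (k / m ^+ 2); first by rewrite divr_ge0// sqr_ge0.
exists s; first by rewrite lt_min r0 divr_gt0.
move=> y z ys zs.
have fy0 : f y != 0 by rewrite -normr_gt0 (lt_le_trans m0)// fm.
have fz0 : f z != 0 by rewrite -normr_gt0 (lt_le_trans m0)// fm.
have -> : (f z)^-1 - (f y)^-1 = - ((f z - f y) / (f z * f y)) by field; apply/andP.
rewrite normrN normrM normfV normrM mulrAC.
have : `|f z - f y| <= k * `|z - y|.
  by apply: fk; [move: ys|move: zs]; rewrite lt_min => /andP[].
move=> H; apply: ler_pM => //.
by rewrite lef_pV2 ?posrE ?exprn_gt0 ?mulr_gt0 ?normr_gt0// expr2 ler_pM ?fm ?ltW.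
Qed.

Lemma lip_near_det n (A : V -> 'M[R]_n) x :
  (forall i j, lip_near (fun y => A y i j) x) -> lip_near (fun y => \det (A y)) x.
Proof.
move=> Al; apply: lip_near_sum => s _; apply: lip_nearM; first exact: lip_near_cst.
by apply: lip_near_prod.
Qed.

(** Cramer's rule. Invertibility is asked on a whole ball because [invmx] returns its argument on
    singular matrices. *)
Lemma lip_near_invmx n (A : V -> 'M[R]_n) x :
  (forall i j, lip_near (fun y => A y i j) x) ->
  (exists2 r : R, 0 < r & forall y, `|y - x| < r -> A y \in unitmx) ->
  forall i j, lip_near (fun y => invmx (A y) i j) x.
Proof.
move=> Al [r r0 Au] i j.
have : lip_near (fun y => (\det (A y))^-1 * cofactor (A y) j i) x.
  apply: lip_nearM.
    apply: lip_nearV; first exact: lip_near_det.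
    by have := Au x; rewrite subrr normr0 unitmxE unitfE => /(_ r0).
  apply: lip_nearM; first exact: lip_near_cst.
  apply: lip_near_det => k l.
  by move: (Al (lift j k) (lift i l)); congr lip_near; apply/funext => y; rewrite !mxE.
move=> [k k0 [s s0 H]]; exists k => //; exists (Num.min r s); first by rewrite lt_min r0.
move=> y z; rewrite !lt_min => /andP[yr ys] /andP[zr zs].
by rewrite /invmx !Au// !mxE; exact: H.
Qed.

End locally_lipschitz.

Lemma lip_near_comp (R : realType) (U V : normedModType R) (L : U -> V) (k : R)
    (f : V -> R) (x : U) : (forall y z, `|L z - L y| <= k * `|z - y|) ->
  lip_near f (L x) -> lip_near (f \o L) x.
Proof.
move=> Lk [l l0 [r r0 fl]].
have k1 : 0 < `|k| + 1 by rewrite ltr_wpDl.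
have Lk' y z : `|L z - L y| <= (`|k| + 1) * `|z - y|.
  rewrite (le_trans (Lk _ _))// ler_wpM2r// (le_trans (ler_norm _))//.
  by rewrite lerDl.
exists (l * (`|k| + 1)); first by rewrite mulr_ge0// ltW.
exists (r / (`|k| + 1)); first by rewrite divr_gt0.
move=> y z; rewrite !ltr_pdivlMr// (mulrC `|y - x|) (mulrC `|z - x|) => yr zr.
rewrite -mulrA (le_trans (fl _ _ _ _))//.
- exact: le_lt_trans yr.
- exact: le_lt_trans zr.
- by rewrite ler_wpM2l.
Qed.

(** * Second-order Taylor bounds and symmetry of second derivatives *)

Section C2_functions.
Variables (R : realType) (n : nat).
Implicit Types (x y z w v : 'rV[R]_n) (a b : 'I_n) (f : 'rV[R]_n -> R).
Implicit Types (D : set 'rV[R]_n).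

Lemma open_ball_sub D x : open D -> D x ->
  exists2 r : R, 0 < r & forall y, `|y - x| < r -> D y.
Proof.
move=> oD Dx; have /nbhs_normP[r /= r0 rD] : nbhs x D by exact: open_nbhs_nbhs.
by exists r => // y yx; apply: rD; rewrite /ball_/= distrC.
Qed.

Lemma C1_lip_near D f x : open D -> D x -> Ck_on 1 D f -> lip_near f x.
Proof.
move=> oD Dx [_ fa].
(* Near [x] each partial derivative is within 1 of its value at [x]. *)
pose k := \sum_a `|partial a f x| + 1.
have k0 : 0 <= k by rewrite addr_ge0// sumr_ge0.
have : \forall y \near x, D y /\ forall a, `|partial a f x - partial a f y| < 1.
  have H : \forall y \near x, forall a, `|partial a f x - partial a f y| < 1.
    apply: (@filter_forall _ _ (fun a y => `|partial a f x - partial a f y| < 1)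
      _ (nbhs_filter x)).
    move=> a; have [_ [/(_ x Dx) + _]] := fa a.
    by move=> /cvgrPdist_lt; apply.
  by near=> y; split; near: y => //; apply: open_nbhs_nbhs.
move=> /nbhs_normP[r /= r0 rD].
exists (k * n%:R); first by rewrite mulr_ge0.
exists r => // y z yr zr.
apply: (le_trans (@dist_le_partial _ _ f y z k _)) => [w a bw|].
  have [|Dw /(_ a) wx] := rD w.
    by rewrite /ball_/= distrC; exact: between_ball bw.
  split; first by have [fd _] := fa a; exact: fd.
  rewrite -(subrK (partial a f x) (partial a f w)) addrC.
  rewrite (le_trans (ler_normD _ _))// lerD//; last by rewrite distrC ltW.
  by rewrite (bigD1 a)//= lerDl sumr_ge0.
rewrite -mulrA ler_wpM2l//.
by have := sum_coord_le_norm (z - y); under eq_bigr do rewrite !mxE.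
Unshelve. all: by end_near. Qed.

(** The expansion point [y] varies, with one constant near [x]: the metric will be expanded around
    the moving point of a geodesic. *)
Lemma C2_taylor D f x : open D -> D x -> Ck_on 2 D f -> exists2 k : R, 0 <= k &
  exists2 r : R, 0 < r & forall y z, `|y - x| < r -> `|z - x| < r ->
    `|f z - f y - \sum_a partial a f y * (z 0 a - y 0 a)| <= k * `|z - y| ^+ 2.
Proof.
move=> oD Dx [_ fa].
have [k k0 [r r0 H]] : exists2 k : R, 0 <= k &
  exists2 r : R, 0 < r & forall a y z, `|y - x| < r -> `|z - x| < r ->
    `|partial a f z - partial a f y| <= k * `|z - y|.
  by apply: lip_near_family => a; have [_ ] := fa a; exact: C1_lip_near.
have [s s0 sD] := open_ball_sub oD Dx.
exists (k * n%:R); first by rewrite mulr_ge0.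
exists (Num.min r s) => [|y z]; first by rewrite lt_min r0.
rewrite !lt_min => /andP[yr ys] /andP[zr zs].
apply: (le_trans (@expansion_le _ _ f y z (fun a => partial a f y) (k * `|z - y|) _ _)).
- move=> w a bw; split.
    by have [fd _] := fa a; apply/fd/sD; exact: between_ball bw.
  rewrite (le_trans (H _ _ _ yr _))//; first exact: between_ball bw.
  by rewrite ler_wpM2l// between_norm.
- by rewrite mulr_ge0.
- by rewrite [leRHS](_ : _ = k * `|z - y| * (n%:R * `|z - y|)) //; ring.
Qed.

(** The second difference over a square of side [h], by the mean value theorem in the direction [a],
    then in the direction [b]. *)
Lemma mixed_difference D f x (r h : R) a b : (forall y, `|y - x| < r -> D y) ->
  Ck_on 2 D f -> 0 < h -> h + h < r ->
  exists2 y, `|y - x| <= h + h &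
    f (x + h *: delta_mx 0 a + h *: delta_mx 0 b) - f (x + h *: delta_mx 0 a)
    - (f (x + h *: delta_mx 0 b) - f x) = h ^+ 2 * partial b (partial a f) y.
Proof.
move=> rD [_ fa] h0 hr.
have dn c : `|delta_mx 0 c : 'rV[R]_n| <= 1.
  by apply: rV_norm_le => // d; rewrite mxE eqxx/=; case: eqP; rewrite ?normr1 ?normr0.
have near_x (s t : R) : 0 <= s <= h -> 0 <= t <= h ->
    `|x + s *: delta_mx 0 a + t *: delta_mx 0 b - x| <= h + h.
  move=> /andP[s0 sh] /andP[t0 th].
  rewrite -(addrA x) [X in `|X|]addrC addKr (le_trans (ler_normD _ _))// !normrZ.
  by rewrite !ger0_norm// lerD// -[h]mulr1 ler_pM.
have inD s t : 0 <= s <= h -> 0 <= t <= h ->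
    D (x + s *: delta_mx 0 a + t *: delta_mx 0 b).
  by move=> sh th; apply: rD; rewrite (le_lt_trans (near_x _ _ sh th)).
have h00 : 0 <= (0 : R) <= h by rewrite lexx ltW.
have hh : 0 <= h <= h by rewrite lexx ltW.
pose phi s := f (x + h *: delta_mx 0 b + s *: delta_mx 0 a) - f (x + s *: delta_mx 0 a).
pose dphi s := partial a f (x + h *: delta_mx 0 b + s *: delta_mx 0 a)
   - partial a f (x + s *: delta_mx 0 a).
have [|s sh E1] := @MVT_le _ phi dphi 0 h (ltW h0).
  move=> s sh; apply: is_deriveB; apply: is_derive_along.
    by rewrite addrAC; apply: (fa a).1; exact: inD.
  by apply: (fa a).1; have := inD s 0 sh h00; rewrite scale0r addr0.
pose psi t := partial a f (x + s *: delta_mx 0 a + t *: delta_mx 0 b).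
pose dpsi t := partial b (partial a f) (x + s *: delta_mx 0 a + t *: delta_mx 0 b).
have [|t th E2] := @MVT_le _ psi dpsi 0 h (ltW h0).
  move=> t th; apply: is_derive_along.
  by have [_ [_ /(_ b)[+ _]]] := fa a; apply; exact: inD.
exists (x + s *: delta_mx 0 a + t *: delta_mx 0 b); first exact: near_x.
rewrite -/(dpsi t) expr2 -mulrA.
rewrite subr0 [RHS]mulrC in E2; rewrite -E2.
have -> : psi h - psi 0 = dphi s by rewrite /psi /dphi scale0r addr0 addrAC.
rewrite subr0 [RHS]mulrC in E1; rewrite -E1.
by rewrite /phi scale0r !addr0 (addrAC x).
Qed.

(** Schwarz's theorem: the second difference is symmetric in [a] and [b], so the two mixed
    derivatives agree at two points within [h + h] of [x], and continuity concludes. *)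
Lemma partialC D f x a b : open D -> D x -> Ck_on 2 D f ->
  partial a (partial b f) x = partial b (partial a f) x.
Proof.
move=> oD Dx f2.
have [r r0 rD] := open_ball_sub oD Dx.
apply/eqP; rewrite -subr_eq0 -normr_le0; apply/ler_addgt0Pr => e e0; rewrite add0r.
have cont c d : exists2 s : R, 0 < s & forall y, `|y - x| < s ->
    `|partial c (partial d f) x - partial c (partial d f) y| <= e / 2.
  have [_ /(_ d)[_ [_ /(_ c)[_ [/(_ x Dx) + _]]]]] := f2.
  have e20 : 0 < e / 2 by rewrite divr_gt0.
  move=> /cvgrPdist_le /(_ _ e20) /nbhs_normP[s /= s0 H]; exists s => // y yx; apply: H.
  by rewrite /ball_/= distrC.
have [s s0 sP] := cont a b; have [t t0 tP] := cont b a.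
pose h := Num.min r (Num.min s t) / 4.
have m0 : 0 < Num.min r (Num.min s t) by rewrite !lt_min r0 s0.
have h0 : 0 < h by rewrite divr_gt0.
have : h + h < Num.min r (Num.min s t) by rewrite /h; lra.
rewrite !lt_min => /andP[hr /andP[hs ht]].
have [y yx Ey] := mixed_difference a b rD f2 h0 hr.
have [z zx Ez] := mixed_difference b a rD f2 h0 hr.
have E : partial b (partial a f) y = partial a (partial b f) z.
  apply: (@mulfI _ (h ^+ 2)); first by rewrite expf_neq0// gt_eqF.
  apply: etrans (esym Ey) (etrans _ Ez); rewrite [x + _ + _]addrAC.
  by rewrite !opprB addrACA [RHS]addrACA; congr (_ + _); exact: addrC.
have := sP z (le_lt_trans zx hs); have := tP y (le_lt_trans yx ht); rewrite E.
move: (partial a (partial b f) x) (partial b (partial a f) x) (partial _ _ z) => u v w.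
by clear; rewrite !ler_norml => /andP[? ?] /andP[? ?]; apply/andP; split; lra.
Qed.

End C2_functions.

(** * Primitives and ordinary differential equations *)

Section primitives.
Variable R : realType.
Implicit Types (f G : R -> R) (a b : R).
Let mu := @lebesgue_measure R.

Lemma primitive_itv f a b : (forall t, a <= t <= b -> {for t, continuous f}) ->
  exists G, forall t, a < t < b -> is_derive t 1 G (f t).
Proof.
move=> fc.
exists (fun t => (\int[mu]_(s in `[a, t]) f s)%R) => t /andP[at_ tb].
have fi : mu.-integrable `[a, b] (EFin \o f).
  apply: continuous_compact_integrable; first exact: segment_compact.
  apply: continuous_in_subspaceT => s; rewrite inE/= in_itv/=; exact: fc.
have ft : {for t, continuous f} by apply: fc; rewrite !ltW.
have [dG <-] := continuous_FTC1_closed tb fi at_ ft.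
by rewrite derive1E; exact/derivableP.
Qed.

Lemma Rintegral_primitive f G a b : a <= b ->
  (forall t, a <= t <= b -> {for t, continuous f}) ->
  (forall t, a <= t <= b -> is_derive t 1 G (f t)) ->
  (\int[mu]_(s in `[a, b]) f s)%R = G b - G a.
Proof.
rewrite le_eqVlt => /predU1P[->|ab] fc Gd.
  by rewrite subrr set_itv1 Rintegral_set1.
rewrite /Rintegral (@continuous_FTC2 R f G a b)//.
- by apply: continuous_in_subspaceT => s; rewrite inE/= in_itv/=; exact: fc.
- split => [t /[!in_itv]/= /andP[t1 t2]||].
  + by have [] := Gd t (introT andP (conj (ltW t1) (ltW t2))).
  + by apply: cvg_at_right_filter; apply: is_derive1_continuous (Gd a _); rewrite lexx ltW.
  + by apply: cvg_at_left_filter; apply: is_derive1_continuous (Gd b _); rewrite lexx ltW.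
- move=> t /[!in_itv]/= /andP[t1 t2]; rewrite derive1E.
  by have [_ ->] := Gd t (introT andP (conj (ltW t1) (ltW t2))).
Qed.

(** The 1-Lipschitz retraction of the line onto [c - r, c + r]. Precomposing with it turns local
    data (primitives, limits of iterates, vector fields) into global data. *)
Definition clamp (c r t : R) := Num.max (c - r) (Num.min (c + r) t).

Lemma clamp_lip c r s t : `|clamp c r t - clamp c r s| <= `|t - s|.
Proof.
have mx (x y z : R) : `|Num.max x y - Num.max x z| <= `|y - z|.
  have := ler_norm (y - z); have := ler_norm (z - y); rewrite distrC.
  by case: (leP x y) => ?; case: (leP x z) => ? ? ?; rewrite ler_norml;
    apply/andP; split; lra.
have mn (x y z : R) : `|Num.min x y - Num.min x z| <= `|y - z|.
  have := mx (- x) (- y) (- z); rewrite -!oppr_min.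
  by rewrite -!opprD !normrN.
exact: le_trans (mx _ _ _) (mn _ _ _).
Qed.

Lemma clamp_dist c r t : 0 <= r -> `|clamp c r t - c| <= r.
Proof.
by move=> r0; rewrite /clamp ler_norml; case: (leP (c + r) t) => ?;
  rewrite maxEle; case: ifP => ?; apply/andP; split; lra.
Qed.

Lemma clamp_id c r t : `|t - c| <= r -> clamp c r t = t.
Proof.
rewrite ler_norml => /andP[? ?]; rewrite /clamp min_r ?max_r//; lra.
Qed.

Lemma clamp_continuous c r : continuous (clamp c r).
Proof.
move=> t; apply/cvgrPdist_lt => e e0; near=> s.
apply: (le_lt_trans (clamp_lip _ _ _ _)).
by near: s; apply: cvgr_dist_lt.
Unshelve. all: by end_near. Qed.

(** The result is continuous on the whole line although it is a primitive only on ]-1, 1[: Picard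
    iterates can thus be plain continuous functions on R. *)
Lemma primitive_continuous : exists P : (R -> R) -> R -> R, forall f, continuous f ->
  [/\ P f 0 = 0, continuous (P f) & forall t : R, `|t| < 1 -> is_derive t 1 (P f) (f t)].
Proof.
suff /choice[P HP] : forall f, exists G, continuous f ->
  [/\ G 0 = 0, continuous G & forall t : R, `|t| < 1 -> is_derive t 1 G (f t)] by exists P.
move=> f; have [fc|nfc] := pselect (continuous f); last by exists f.
(* The clamped time lies in [-1, 1], in the interior of this interval, where [G] is derivable. *)
have [G HG] := @primitive_itv f (- 2) 2 (fun t _ => fc t).
exists (fun t => G (clamp 0 1 t) - G 0) => _; split.
- by rewrite clamp_id ?subrr// normr0.
- move=> t; suff Gc : {for t, continuous (G \o clamp 0 1)} by exact: (cvgB Gc (cvg_cst _)).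
  apply: continuous_comp; first exact: clamp_continuous.
  apply: is_derive1_continuous (HG _ _).
  have := clamp_dist 0 t (@ler01 R); rewrite subr0 ler_norml.
  by move=> /andP[? ?]; apply/andP; split; lra.
- move=> t t1; rewrite -[f t]subr0; apply: is_deriveB.
  have HGt : is_derive t 1 G (f t).
    by apply: HG; move: t1; rewrite ltr_norml => /andP[? ?]; apply/andP; split; lra.
  apply: near_eq_is_derive HGt; near=> s.
  rewrite clamp_id// subr0 ltW//; near: s.
  by apply: (@cvgr_lt _ _ _ _ (fun s : R => `|s|) `|t|) => //; apply: cvg_norm.
Unshelve. all: by end_near. Qed.

(** The intervals of radius [2 * C / 2 ^+ j] around [u j] are nested, this radius being the sum of
    the increments still to come. The limit is the supremum of their lower ends. *)
Lemma geometric_limit (u : nat -> R) (C : R) :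
  (forall j, `|u j.+1 - u j| <= C / 2 ^+ j) ->
  exists l, forall j, `|u j - l| <= 2 * C / 2 ^+ j.
Proof.
move=> uC.
have C0 j : 0 <= C / 2 ^+ j by rewrite (le_trans _ (uC j)).
have half j : C / 2 ^+ j.+1 = C / 2 ^+ j / 2 by rewrite exprS invfM mulrA mulrAC.
pose w j := u j - 2 * (C / 2 ^+ j); pose v j := u j + 2 * (C / 2 ^+ j).
have wS j : w j <= w j.+1.
  by rewrite /w half; have := uC j; rewrite ler_norml => /andP[? ?]; lra.
have vS j : v j.+1 <= v j.
  by rewrite /v half; have := uC j; rewrite ler_norml => /andP[? ?]; lra.
have wm j k : (j <= k)%N -> w j <= w k by apply/(nondecreasing_seqP w).1.
have vm j k : (j <= k)%N -> v k <= v j. by apply/(nonincreasing_seqP v).1.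
have wv j k : w j <= v k.
  apply: (le_trans (wm _ _ (leq_maxl j k))).
  apply: le_trans (vm _ _ (leq_maxr j k)).
  by rewrite /w /v; have := C0 (maxn j k); lra.
have hs : has_sup [set w j | j in [set: nat]].
  by split; [exists (w 0%N), 0%N | exists (v 0%N) => _ [j _ <-]].
exists (sup [set w j | j in [set: nat]]) => j.
have : w j <= sup [set w j | j in [set: nat]] by apply: sup_ubound; [exact: hs.2|exists j].
have : sup [set w j | j in [set: nat]] <= v j.
  by apply: ge_sup; [exact: hs.1|move=> _ [k _ <-]].
by rewrite /w /v ler_norml -mulrA => ? ?; apply/andP; split; lra.
Qed.

End primitives.

Lemma dist_le_derive_rV (R : realType) (m : nat) (c dc : R -> 'rV[R]_m) (a b e : R) :
  0 <= e ->
  (forall x, Num.min a b <= x <= Num.max a b -> is_derive x 1 c (dc x)) ->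
  (forall x, Num.min a b <= x <= Num.max a b -> `|dc x| <= e) ->
  `|c b - c a| <= e * `|b - a|.
Proof.
move=> e0 cd ce; apply: rV_norm_le => [|i]; first by rewrite mulr_ge0.
rewrite !mxE; apply: (@dist_le_derive _ (fun t => c t 0 i) (fun t => dc t 0 i)) => x xab.
  by apply: is_derive_coord; exact: cd.
by rewrite (le_trans (coord_le_norm _ _))// ce.
Qed.

Lemma lipschitz_cts (R : realType) (V W : normedModType R) (f : V -> W) (k : R) :
  (forall y z, `|f z - f y| <= k * `|z - y|) -> continuous f.
Proof.
move=> fk y; apply/cvgrPdist_lt => e e0; near=> z.
apply: (le_lt_trans (fk _ _)).
rewrite (@le_lt_trans _ _ ((`|k| + 1) * `|y - z|))//.
  by rewrite ler_wpM2r// (le_trans (ler_norm _))// lerDl.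
rewrite mulrC -ltr_pdivlMr ?ltr_wpDl//; near: z.
by apply: (@cvgr_dist_lt _ _ _ _ _ id) => //; rewrite divr_gt0// ltr_wpDl.
Unshelve. all: by end_near. Qed.

Lemma continuous_rV (R : realType) (m : nat) (T : topologicalType) (c : T -> 'rV[R]_m) (t : T) :
  (forall i, {for t, continuous (fun t => c t 0 i)}) -> {for t, continuous c}.
Proof.
move=> ci; apply/cvgrPdist_lt => e e0.
have H : \forall s \near t, forall i, `|c t 0 i - c s 0 i| < e / 2.
  apply: (@filter_forall _ _ (fun i s => `|c t 0 i - c s 0 i| < e / 2)) => i.
  by have /cvgrPdist_lt := ci i; apply; rewrite divr_gt0.
near=> s; have Hs : forall i, `|c t 0 i - c s 0 i| < e / 2 by near: s.
rewrite (@le_lt_trans _ _ (e / 2)) ?ltr_pdivrMr ?ltr_pMr ?ltr1n//.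
apply: rV_norm_le => [|i]; first by rewrite divr_ge0 ?ltW.
by rewrite !mxE ltW.
Unshelve. all: by end_near. Qed.

(** * Picard iteration *)

Section picard.
Variables (R : realType) (m : nat) (F : 'rV[R]_m -> 'rV[R]_m) (k : R).
Hypothesis k0 : 0 <= k.
Hypothesis Fk : forall y z, `|F z - F y| <= k * `|z - y|.

Let Fc : continuous F. Proof. exact: lipschitz_cts Fk. Qed.

Lemma picard_lindelof (y0 : 'rV[R]_m) : exists2 d : R, 0 < d &
  exists2 y : R -> 'rV[R]_m, y 0 = y0 &
    forall t : R, `|t| < d -> is_derive t 1 y (F (y t)).
Proof.
have [P HP] := primitive_continuous R.
pose step (y : R -> 'rV[R]_m) (t : R) := y0 + \row_i P (fun s => F (y s) 0 i) t.
have Fyc (y : R -> 'rV[R]_m) i : continuous y -> continuous (fun s => F (y s) 0 i).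
  move=> yc t; apply: (@continuous_comp _ _ _ (F \o y) (fun v => v 0 i)).
    by apply: continuous_comp; [exact: yc|exact: Fc].
  exact: matrix_normedtype.coord_continuous.
have stepc y : continuous y -> continuous (step y).
  move=> yc t; apply: continuous_rV => i.
  rewrite (_ : (fun t => _) = fun t => y0 0 i + P (fun s => F (y s) 0 i) t); last first.
    by apply/funext => s; rewrite !mxE.
  by apply: cvgD; [exact: cvg_cst|have [_ + _] := HP _ (Fyc y i yc); apply].
have step0 y : continuous y -> step y 0 = y0.
  move=> yc; apply/rowP => i; rewrite !mxE.
  by have [-> _ _] := HP _ (Fyc y i yc); rewrite addr0.
have stepd y (t : R) : continuous y -> `|t| < 1 -> is_derive t 1 (step y) (F (y t)).
  move=> yc t1; apply: is_derive_rV => i.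
  rewrite (_ : (fun t => _) = fun t => y0 0 i + P (fun s => F (y s) 0 i) t); last first.
    by apply/funext => s; rewrite !mxE.
  rewrite -[F _ _ _]add0r; apply: is_deriveD.
  by have [_ _] := HP _ (Fyc y i yc); apply.
(* This makes the iteration contract by [k * d <= 1 / 2], and [d < 1] keeps times in the range where
   the primitives are valid. *)
pose d : R := (2 * (k + 1))^-1.
have k1 : 0 < k + 1 by rewrite ltr_wpDl.
have d0 : 0 < d by rewrite invr_gt0 mulr_gt0.
have d1 : d < 1.
  have k20 : 1 < 2 * (k + 1) by have := k0; lra.
  by rewrite invf_lt1// (lt_trans _ k20).
have kd : k * d <= 2^-1.
  rewrite /d invfM mulrCA ger_pMr ?invr_gt0// ler_pdivrMr// mul1r; lra.
have between0 t x : `|t| < d -> Num.min 0 t <= x <= Num.max 0 t -> `|x| < d.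
  by rewrite !ltr_norml; case: (leP 0 t) => ? /andP[? ?] /andP[? ?]; apply/andP; split; lra.
pose y := fun j => iter j step (cst y0).
have yc j : continuous (y j).
  elim: j => [t|j]; first exact: cvg_cst.
  exact: stepc.
have yd j (t : R) : `|t| < 1 -> is_derive t 1 (y j.+1) (F (y j t)).
  exact: stepd (yc j).
have yS0 j : y j 0 = y0 by case: j => [//|j]; exact: step0.
pose C := `|F y0| * d.
have C0 : 0 <= C by rewrite mulr_ge0// ltW.
have diff j t : `|t| < d -> `|y j.+1 t - y j t| <= C / 2 ^+ j.
  elim: j t => [|j ih] t td.
    rewrite expr0 divr1.
    have -> : y 0%N t = y 1%N 0 by rewrite yS0.
    apply: (le_trans (@dist_le_derive_rV _ _ (y 1%N) (fun s => F y0) 0 t `|F y0| _ _ _)) => //.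
      move=> x /(between0 _ _ td) xd.
      by apply: (yd 0%N); exact: lt_trans d1.
    by rewrite subr0 /C ler_wpM2l// ltW.
  have -> : y j.+2 t - y j.+1 t = (y j.+2 t - y j.+1 t) - (y j.+2 0 - y j.+1 0).
    by rewrite !yS0 subrr subr0.
  have e0 : 0 <= k * (C / 2 ^+ j) by rewrite mulr_ge0// divr_ge0.
  apply: (le_trans (@dist_le_derive_rV _ _ (fun s => y j.+2 s - y j.+1 s)
     (fun s => F (y j.+1 s) - F (y j s)) 0 t _ e0 _ _)).
  - move=> x /(between0 _ _ td) xd.
    by apply: is_deriveB; apply: yd; exact: lt_trans xd d1.
  - move=> x /(between0 _ _ td) xd; apply: (le_trans (Fk _ _)).
    by rewrite ler_wpM2l// ih.
  - rewrite subr0 (@le_trans _ _ (k * (C / 2 ^+ j) * d)) ?ler_wpM2l ?(ltW td)//.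
    rewrite mulrAC (_ : C / 2 ^+ j.+1 = 2^-1 * (C / 2 ^+ j)); last first.
      by rewrite exprS invfM mulrCA.
    by rewrite ler_wpM2r// divr_ge0.
have /choice[l Hl] t : exists l : 'rV[R]_m, `|t| < d -> forall j, `|y j t - l| <= 2 * C / 2 ^+ j.
  have [td|_] := boolP (`|t| < d); last by exists 0.
  have /choice[l Hl] i : exists l, forall j, `|y j t 0 i - l| <= 2 * C / 2 ^+ j.
    apply: geometric_limit => j.
    by have := coord_le_norm (y j.+1 t - y j t) i; rewrite !mxE => /le_trans; apply; exact: diff.
  exists (\row_i l i) => _ j; apply: rV_norm_le => [|i]; last by rewrite !mxE.
  by rewrite divr_ge0// mulr_ge0.
(* All iterates stay within 4 C of [y0], so [L] bounds their speed. This common Lipschitz constant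
   passes to the limit and makes it continuous. *)
pose L := `|F y0| + k * (4 * C).
have L0 : 0 <= L by rewrite addr_ge0// mulr_ge0// mulr_ge0.
have yL j s t : `|s| < d -> `|t| < d -> `|y j t - y j s| <= L * `|t - s|.
  move=> sd td; have bt x : Num.min s t <= x <= Num.max s t -> `|x| < d.
    move: sd td; rewrite !ltr_norml => /andP[? ?] /andP[? ?].
    by case: (leP s t) => ? /andP[? ?]; apply/andP; split; lra.
  case: j => [|j]; first by rewrite subrr normr0 mulr_ge0.
  apply: (@dist_le_derive_rV _ _ _ (fun s => F (y j s))) => // x /bt xd.
    by apply: yd; exact: lt_trans xd d1.
  rewrite -(subrK (F y0) (F (y j x))) addrC (le_trans (ler_normD _ _))// lerD2l.
  rewrite (le_trans (Fk _ _))// ler_wpM2l//.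
  have H1 := Hl x xd j; have H2 := Hl x xd 0%N.
  have p2 : 2 * C / 2 ^+ j <= 2 * C.
    have p21 : 1 <= 2 ^+ j :> R by rewrite exprn_ege1// ler1n.
    have C20 : 0 <= 2 * C by rewrite mulr_ge0.
    by rewrite ler_pdivrMr ?exprn_gt0// -[leLHS]mulr1 ler_wpM2l.
  rewrite expr0 divr1 in H2.
  have -> : y j x - y0 = (y j x - l x) - (y 0%N x - l x) by rewrite opprB addrA subrK.
  rewrite (le_trans (ler_normB _ _))// (_ : 4 * C = 2 * C + 2 * C); last by ring.
  by rewrite lerD// (le_trans H1).
(* The passages to the limit below all take this form. *)
have small (e B : R) : (forall j : nat, e <= B / 2 ^+ j) -> e <= 0.
  move=> H; rewrite leNgt; apply/negP => e0.
  pose j := Num.truncn (B / e).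
  have : B / e < 2 ^+ j.+1.
    rewrite (lt_trans (truncnS_gt _))// -natrX ltr_nat.
    exact: ltn_expl.
  by rewrite ltr_pdivrMr// mulrC -ltr_pdivrMr ?exprn_gt0// ltNge H.
have lL s t : `|s| < d -> `|t| < d -> `|l t - l s| <= L * `|t - s|.
  move=> sd td; rewrite -subr_le0; apply: (small _ (4 * C)) => j.
  rewrite lerBlDl.
  have -> : l t - l s = (y j t - y j s) + ((l t - y j t) - (l s - y j s)).
    by apply/rowP => i; rewrite !mxE; ring.
  rewrite (le_trans (ler_normD _ _))// lerD ?yL//.
  rewrite (le_trans (ler_normB _ _))// distrC [X in _ + X]distrC.
  rewrite (_ : 4 * C / 2 ^+ j = 2 * C / 2 ^+ j + 2 * C / 2 ^+ j); last by ring.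
  by rewrite lerD ?Hl.
have l0 : l 0 = y0.
  apply/eqP; rewrite -subr_eq0 -normr_le0; apply: (small _ (2 * C)) => j.
  by rewrite distrC -{1}(yS0 j) Hl// normr0.
(* The limit [l] is controlled only for |t| < d, whereas [step] acts well on functions continuous
   everywhere; freezing time outside [-d/2, d/2] provides one. *)
pose d' := d / 2.
have d'0 : 0 < d' by rewrite divr_gt0.
have d'd : d' < d by rewrite ltr_pdivrMr// ltr_pMr// ltr1n.
pose lc t := l (clamp 0 d' t).
have cd t : `|clamp 0 d' t| < d.
  by have := clamp_dist 0 t (ltW d'0); rewrite subr0 => /le_lt_trans; apply.
have lcc : continuous lc.
  apply: (@lipschitz_cts _ _ _ _ L) => s t.
  apply: (le_trans (lL _ _ (cd s) (cd t))).
  by rewrite ler_wpM2l//; exact: clamp_lip.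
have lcE (t : R) : `|t| < d' -> lc t = l t.
  by move=> td; rewrite /lc clamp_id// subr0 ltW.
(* Fixed-point equation: [l] is within 2 C / 2^(j+1) of the iterate j + 1, which is within 2 C / 2^j
   of [step lc]; together 3 C / 2^j. *)
have lE (t : R) : `|t| < d' -> l t = step lc t.
  move=> td; have td2 := lt_trans td d'd.
  apply/eqP; rewrite -subr_eq0 -normr_le0; apply: (small _ (3 * C)) => j.
  have -> : l t - step lc t = (l t - y j.+1 t) + ((y j.+1 t - step lc t) - (y j.+1 0 - step lc 0)).
    by rewrite yS0 step0// subrr subr0 addrA subrK.
  rewrite (le_trans (ler_normD _ _))//.
  rewrite (_ : 3 * C / 2 ^+ j = 2 * C / 2 ^+ j.+1 + 2 * C / 2 ^+ j); last first.
    by rewrite exprS; field; rewrite expf_neq0.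
  rewrite lerD//; first by rewrite distrC Hl.
  have e0 : 0 <= k * (2 * C / 2 ^+ j) by rewrite mulr_ge0// divr_ge0// mulr_ge0.
  apply: (le_trans (@dist_le_derive_rV _ _ (fun s => y j.+1 s - step lc s)
     (fun s => F (y j s) - F (lc s)) 0 t _ e0 _ _)).
  - move=> x /(between0 _ _ td2) xd.
    by apply: is_deriveB; [apply: yd|apply: stepd => //]; exact: lt_trans xd d1.
  - move=> x xt; have xd' : `|x| < d'.
      move: td xt; rewrite !ltr_norml => /andP[? ?].
      by case: (leP 0 t) => ? /andP[? ?]; apply/andP; split; lra.
    apply: (le_trans (Fk _ _)); rewrite ler_wpM2l// lcE// Hl//.
    exact: lt_trans d'd.
  - rewrite subr0 (@le_trans _ _ (k * (2 * C / 2 ^+ j) * d)) ?ler_wpM2l ?(ltW td2)//.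
    rewrite mulrAC ler_piMl ?divr_ge0 ?mulr_ge0//; lra.
exists d' => //; exists l => // t td.
rewrite -(lcE t td); apply: near_eq_is_derive (stepd lc t lcc _); last first.
  by rewrite (lt_trans td)// (lt_trans d'd).
near=> s; rewrite lE//; near: s.
by apply: (@cvgr_lt _ _ _ _ (fun s : R => `|s|) `|t|) => //; apply: cvg_norm.
Unshelve. all: by end_near. Qed.

End picard.

(** Clamping each coordinate to within r/2 of [y0] makes the field globally Lipschitz. By continuity
    the solution stays for a short time where clamping changes nothing. *)
Lemma local_ode (R : realType) (m : nat) (F : 'rV[R]_m -> 'rV[R]_m) (y0 : 'rV[R]_m) :
  (forall i, lip_near (fun y => F y 0 i) y0) ->
  exists2 d : R, 0 < d & exists2 y : R -> 'rV[R]_m, y 0 = y0 &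
    forall t : R, `|t| < d -> is_derive t 1 y (F (y t)).
Proof.
move=> /lip_near_family[k k0 [r r0 Fk]].
pose cl (y : 'rV[R]_m) : 'rV[R]_m := \row_i clamp (y0 0 i) (r / 2) (y 0 i).
have r20 : 0 < r / 2 by rewrite divr_gt0.
have cl_lip y z : `|cl z - cl y| <= `|z - y|.
  apply: rV_norm_le => // i; rewrite !mxE (le_trans (clamp_lip _ _ _ _))//.
  by have := coord_le_norm (z - y) i; rewrite !mxE.
have cl_in y : `|cl y - y0| < r.
  rewrite (@le_lt_trans _ _ (r / 2)) ?ltr_pdivrMr ?ltr_pMr ?ltr1n//.
  by apply: rV_norm_le => [|i]; [exact: ltW|rewrite !mxE clamp_dist// ltW].
have Fcl y z : `|(F \o cl) z - (F \o cl) y| <= k * `|z - y|.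
  apply: rV_norm_le => [|i]; first by rewrite mulr_ge0.
  rewrite !mxE (le_trans (Fk _ _ _ (cl_in _) (cl_in _)))//.
  by rewrite ler_wpM2l.
have [d d0 [y yy0 yd]] := picard_lindelof k0 Fcl y0.
have yc : {for 0, continuous y}.
  by apply: is_derive1_continuous (yd 0 _); rewrite normr0.
have /cvgrPdist_lt /(_ _ r20) := yc.
move=> /nbhs_ballP[e /= e0 ey].
exists (Num.min d e); first by rewrite lt_min d0.
exists y => // t; rewrite lt_min => /andP[td te].
have := yd t td; rewrite /= (_ : cl (y t) = y t)//.
apply/rowP => i; rewrite mxE clamp_id// ltW//.
have /ey : ball 0 e t by rewrite /ball/= sub0r normrN.
rewrite yy0 distrC; apply: le_lt_trans.
by have := coord_le_norm (y t - y0) i; rewrite !mxE.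
Qed.

Lemma local_ode2 (R : realType) (n : nat) (Phi : 'rV[R]_n -> 'rV[R]_n -> 'rV[R]_n)
    (x0 v0 : 'rV[R]_n) :
  (forall a, lip_near (fun z : 'rV[R]_(n + n) => Phi (lsubmx z) (rsubmx z) 0 a)
    (row_mx x0 v0)) ->
  exists2 d : R, 0 < d & exists c v : R -> 'rV[R]_n,
    [/\ c 0 = x0, v 0 = v0 &
      forall t : R, `|t| < d -> is_derive t 1 c (v t) /\ is_derive t 1 v (Phi (c t) (v t))].
Proof.
move=> Pl.
pose F (z : 'rV[R]_(n + n)) := row_mx (rsubmx z) (Phi (lsubmx z) (rsubmx z)).
have [i|d d0 [y y0 yd]] := @local_ode _ _ F (row_mx x0 v0).
  case: (split_ordP i) => a -> {i}.
    rewrite (_ : (fun y => _) = fun y : 'rV[R]_(n + n) => y 0 (rshift n a)); last first.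
      by apply/funext => y; rewrite /F row_mxEl mxE.
    exists 1 => //; exists 1 => // y z _ _; rewrite mul1r.
    by have := coord_le_norm (z - y) (rshift n a); rewrite !mxE.
  rewrite (_ : (fun y => _) = fun y : 'rV[R]_(n + n) => Phi (lsubmx y) (rsubmx y) 0 a)//.
  by apply/funext => y; rewrite /F row_mxEr.
exists d => //; exists (fun t => lsubmx (y t)), (fun t => rsubmx (y t)).
split; rewrite ?y0 ?row_mxKl ?row_mxKr// => t td.
have yt := yd t td.
split; apply: is_derive_rV => a.
  rewrite (_ : (fun t => _) = fun t => y t 0 (lshift n a)); last first.
    by apply/funext => s; rewrite mxE.
  have <- : F (y t) 0 (lshift n a) = rsubmx (y t) 0 a by rewrite /F row_mxEl.
  exact: is_derive_coord.
rewrite (_ : (fun t => _) = fun t => y t 0 (rshift n a)); last first.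
  by apply/funext => s; rewrite mxE.
have <- : F (y t) 0 (rshift n a) = Phi (lsubmx (y t)) (rsubmx (y t)) 0 a.
  by rewrite /F row_mxEr.
exact: is_derive_coord.
Qed.

(** * Charts and geodesics *)

Lemma is_derive_mxP (R : realType) (V : normedModType R) (m n : nat)
    (X : V -> 'M[R]_(m, n)) (s v : V) (dX : 'M[R]_(m, n)) :
  is_derive s v X dX <-> forall i j, is_derive s v (fun t => X t i j) (dX i j).
Proof.
split=> [[Xd <-] i j|Xd].
  by split; [exact: (derivable_mxP _ _ _).1|rewrite (derive_mx Xd) mxE].
have Xdv : derivable X s v by apply/derivable_mxP => i j; have [] := Xd i j.
split=> //; rewrite (derive_mx Xdv); apply/matrixP => i j; rewrite mxE.
by have [] := Xd i j.
Qed.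

Lemma is_derive_sumr (R : realType) (V : normedModType R) (n : nat)
    (f : 'I_n -> V -> R) (df : 'I_n -> R) (s v : V) :
  (forall i, is_derive s v (f i) (df i)) ->
  is_derive s v (fun t => \sum_i f i t) (\sum_i df i).
Proof.
move=> fd; rewrite (_ : (fun t => _) = \sum_i f i); first exact: is_derive_sum.
by apply/funext => t; rewrite fct_sumE.
Qed.

Lemma is_derive_mulmx (R : realType) (V : normedModType R) (m n p : nat)
    (X : V -> 'M[R]_(m, n)) (Y : V -> 'M[R]_(n, p)) (s v : V) dX dY :
  is_derive s v X dX -> is_derive s v Y dY ->
  is_derive s v (fun t => X t *m Y t) (dX *m Y s + X s *m dY).
Proof.
move=> /is_derive_mxP Xd /is_derive_mxP Yd; apply/is_derive_mxP => i j.
rewrite (_ : (fun t => _) = fun t => \sum_k X t i k * Y t k j); last first.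
  by apply/funext => t; rewrite mxE.
rewrite [X in is_derive _ _ _ X](_ : _ =
  \sum_k (X s i k *: dY k j + Y s k j *: dX i k)); last first.
  rewrite !mxE -big_split/=; apply: eq_bigr => k _.
  by rewrite addrC; congr (_ + _); exact: mulrC.
by apply: is_derive_sumr => k; exact: is_deriveM.
Qed.

Lemma is_derive_trmx (R : realType) (V : normedModType R) (m n : nat)
    (X : V -> 'M[R]_(m, n)) (s v : V) dX :
  is_derive s v X dX -> is_derive s v (fun t => (X t)^T) dX^T.
Proof.
move=> /is_derive_mxP Xd; apply/is_derive_mxP => i j; rewrite mxE.
by rewrite (_ : (fun t => _) = fun t => X t j i)//; apply/funext => t; rewrite mxE.
Qed.

Lemma is_derive_unique (R : realType) (V W : normedModType R) (f : V -> W)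
    (s v : V) (d e : W) : is_derive s v f d -> is_derive s v f e -> d = e.
Proof. by move=> [_ <-] [_ <-]. Qed.

Section bilinear.
Variables (R : realType) (n : nat).
Implicit Types (G : 'M[R]_n) (u v w : 'rV[R]_n).

Definition bil G u w : R := (u *m G *m w^T) 0 0.

Lemma bilE G u w : bil G u w = \sum_a \sum_b G a b * u 0 a * w 0 b.
Proof.
rewrite /bil mxE exchange_big/=; apply: eq_bigr => b _.
by rewrite !mxE mulr_suml; apply: eq_bigr => a _; rewrite (mulrC (u 0 a)).
Qed.

Lemma bilC G u w : G^T = G -> bil G u w = bil G w u.
Proof.
move=> GT; rewrite /bil -[LHS]/(_ 0 0) -(trmxK (u *m G *m w^T)) [LHS]mxE.
by rewrite !trmx_mul trmxK GT mulmxA.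
Qed.

Lemma bilDl G u v w : bil G (u + v) w = bil G u w + bil G v w.
Proof. by rewrite /bil !mulmxDl mxE. Qed.

Lemma bilDr G u v w : bil G w (u + v) = bil G w u + bil G w v.
Proof. by rewrite /bil linearD/= mulmxDr mxE. Qed.

Lemma bilZl G k u w : bil G (k *: u) w = k * bil G u w.
Proof. by rewrite /bil -!scalemxAl mxE. Qed.

Lemma bilZr G k u w : bil G u (k *: w) = k * bil G u w.
Proof. by rewrite /bil linearZ/= -scalemxAr mxE. Qed.

Lemma bilD G H u w : bil (G + H) u w = bil G u w + bil H u w.
Proof. by rewrite /bil mulmxDr mulmxDl mxE. Qed.

Lemma bil_le G u w (e : R) : 0 <= e -> (forall a b, `|G a b| <= e) ->
  `|bil G u w| <= n%:R ^+ 2 * e * `|u| * `|w|.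
Proof.
move=> e0 Ge; rewrite bilE (le_trans (ler_norm_sum _ _ _))//.
rewrite (@le_trans _ _ (\sum_(a < n) \sum_(b < n) (e * `|u| * `|w|)))//.
  apply: ler_sum => a _; rewrite (le_trans (ler_norm_sum _ _ _))//.
  apply: ler_sum => b _; rewrite !normrM.
  apply: ler_pM; rewrite ?mulr_ge0 ?coord_le_norm//.
  by apply: ler_pM => //; exact: coord_le_norm.
by rewrite !sumr_const card_ord -mulrnA -[leLHS]mulr_natl natrM -expr2 !mulrA.
Qed.

End bilinear.

(** * Changes of coordinates and their second derivatives *)

Section charts.
Variables (R : realType) (n : nat) (M : topologicalType) (A : smooth_atlas R n M).
Implicit Types (i j : chart A) (p : M) (x w : 'rV[R]_n).

Definition overlap i j : set 'rV[R]_n := coord i @` (dom i `&` dom j).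

Lemma img_coord i p : dom i p -> img i (coord i p).
Proof. by exists p. Qed.

Lemma dom_inv_coord i x : img i x -> dom i (inv_coord i x).
Proof. by move=> [p ip <-]; rewrite coordK. Qed.

Lemma inv_coordK i x : img i x -> coord i (inv_coord i x) = x.
Proof. by move=> [p ip <-]; rewrite coordK. Qed.

Lemma overlap_coord i j p : dom i p -> dom j p -> overlap i j (coord i p).
Proof. by exists p. Qed.

Lemma overlap_img i j x : overlap i j x -> img i x.
Proof. by move=> [p [ip _] <-]; exists p. Qed.

Lemma overlap_dom i j x : overlap i j x -> dom j (inv_coord i x).
Proof. by move=> [p [ip jp] <-]; rewrite coordK. Qed.

Lemma overlap_open i j : open (overlap i j).
Proof.
rewrite openE => x [p [ip jp] <-]; rewrite /interior.
have ix := img_coord ip.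
have H1 : \forall y \near coord i p, img i y.
  by apply: open_nbhs_nbhs; split; [exact: img_open|].
have H2 : \forall y \near coord i p, dom j (inv_coord i y).
  have := inv_coord_continuous ix; apply.
  by rewrite coordK//; apply: open_nbhs_nbhs; split; [exact: dom_open|].
apply: filterS2 H1 H2 => y iy jy; exists (inv_coord i y); last exact: inv_coordK.
by split=> //; exact: dom_inv_coord.
Qed.

Lemma near_dom i (gam : R -> M) s : {for s, continuous gam} -> dom i (gam s) ->
  \forall t \near s, dom i (gam t).
Proof.
by move=> gc is_; apply: gc; apply: open_nbhs_nbhs; split; [exact: dom_open|].
Qed.

Lemma transition_C i j (b : 'I_n) k :
  Ck_on k (overlap i j) (fun x => coord j (inv_coord i x) 0 b).
Proof. exact: transition_smooth. Qed.

Lemma transition_derive (V : normedModType R) i j (c : V -> 'rV[R]_n) (s v : V) c' :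
  overlap i j (c s) -> is_derive s v c c' ->
  is_derive s v (fun t => coord j (inv_coord i (c t)))
    (c' *m transition_jacobian i j (c s)).
Proof.
move=> oc cd; apply: is_derive_rV => b.
have := C1_chain (@overlap_open i j) oc (@transition_C i j b 1) cd.
congr (is_derive _ _ _ _); rewrite mxE; apply: eq_bigr => a _.
by rewrite mulrC mxE.
Qed.

(** Derivative of the Jacobian at [x] in the direction [w]; [v *m djacobian i j x w] is the second
    derivative of the change of coordinates in the directions [v] and [w], hence the symmetry proved
    below. *)
Definition djacobian i j x w : 'M[R]_n := \matrix_(a, b) \sum_c
  partial c (partial a (fun y => coord j (inv_coord i y) 0 b)) x * w 0 c.

Lemma jacobian_derive (V : normedModType R) i j (c : V -> 'rV[R]_n) (s v : V) c' :
  overlap i j (c s) -> is_derive s v c c' ->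
  is_derive s v (fun t => transition_jacobian i j (c t)) (djacobian i j (c s) c').
Proof.
move=> oc cd; apply/is_derive_mxP => a b; rewrite !mxE.
have [_ /(_ a)[_ C1]] := @transition_C i j b 2.
have := C1_chain (@overlap_open i j) oc C1 cd.
by congr (is_derive _ _ _ _); apply/funext => t; rewrite mxE.
Qed.

Lemma djacobianC i j x v w : overlap i j x ->
  v *m djacobian i j x w = w *m djacobian i j x v.
Proof.
move=> ox; apply/rowP => b; rewrite !mxE.
under eq_bigr do rewrite mxE mulr_sumr.
rewrite exchange_big/=; apply: eq_bigr => c _.
rewrite mxE mulr_sumr; apply: eq_bigr => a _.
rewrite (partialC c a (@overlap_open i j) ox (@transition_C i j b 2)).
by rewrite mulrCA [RHS]mulrCA (mulrC (v 0 a)).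
Qed.

Lemma coord_change i j (gam : R -> M) s : {for s, continuous gam} ->
  dom i (gam s) -> \forall t \near s,
    coord j (inv_coord i (coord i (gam t))) = coord j (gam t).
Proof.
by move=> gc is_; apply: filterS (near_dom gc is_) => t it; rewrite coordK.
Qed.

Lemma velocity_change i j (gam : R -> M) s v : {for s, continuous gam} ->
  dom i (gam s) -> dom j (gam s) -> is_derive s 1 (coord i \o gam) v ->
  is_derive s 1 (coord j \o gam) (v *m transition_jacobian i j (coord i (gam s))).
Proof.
move=> gc is_ js cd; apply: near_eq_is_derive (coord_change j gc is_) _.
exact: (transition_derive (overlap_coord is_ js) cd).
Qed.

End charts.

(** * Kinetic energy, momentum and force in a chart *)

Section metric.
Variables (R : realType) (n : nat) (M : topologicalType) (A : smooth_atlas R n M).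
Variable g : riemannian_metric A.
Implicit Types (i j : chart A) (p : M) (x v w q : 'rV[R]_n) (gam : R -> M).

Notation nsq i x v := (bil (gmx g i x) v v).
Notation flat i x v := (v *m gmx g i x).

Lemma img_openE i : open (img i).
Proof. exact: img_open. Qed.

Lemma gmx_C i (a b : 'I_n) k : Ck_on k (img i) (fun x => gmx g i x a b).
Proof. exact: gmx_smooth. Qed.

Definition dgmx i x w : 'M[R]_n :=
  \matrix_(a, b) \sum_c partial c (fun y => gmx g i y a b) x * w 0 c.

(** Gradient in [x] of the Lagrangian |v|^2 / 2 at fixed [v]. The geodesic equation becomes the
    Euler-Lagrange equation: the momentum [v *m gmx g i x] has derivative [force]. *)
Definition force i x v : 'rV[R]_n :=
  \row_l (2^-1 * bil (dgmx i x (delta_mx 0 l)) v v).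

Lemma gmx_derive (V : normedModType R) i (c : V -> 'rV[R]_n) (s v : V) c' :
  img i (c s) -> is_derive s v c c' ->
  is_derive s v (fun t => gmx g i (c t)) (dgmx i (c s) c').
Proof.
move=> ic cd; apply/is_derive_mxP => a b; rewrite mxE.
exact: (C1_chain (@img_openE i) ic (@gmx_C i a b 1) cd).
Qed.

Lemma dgmx_delta i x w : dgmx i x w = \sum_l w 0 l *: dgmx i x (delta_mx 0 l).
Proof.
apply/matrixP => a b; rewrite summxE mxE; apply: eq_bigr => l _.
rewrite !mxE (bigD1 l)//= mxE !eqxx mulr1 big1 ?addr0; last first.
  by move=> c cl; rewrite mxE (negbTE cl) andbF mulr0.
exact: mulrC.
Qed.

Lemma force_sum i x v w :
  \sum_l w 0 l * force i x v 0 l = 2^-1 * bil (dgmx i x w) v v.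
Proof.
rewrite (dgmx_delta i x w) /bil mulmx_sumr mulmx_suml summxE mulr_sumr.
apply: eq_bigr => l _; rewrite mxE mulrCA /bil; congr (_ * _).
by rewrite -scalemxAr -scalemxAl [RHS]mxE.
Qed.

Lemma gmx_unit i x : img i x -> gmx g i x \in unitmx.
Proof.
move=> ix; rewrite unitmxE unitfE; apply/det0P => -[v v0 vG].
by have := gmx_pos g ix v0; rewrite vG mul0mx mxE ltxx.
Qed.

Lemma nsq_change i j x v : overlap i j x -> nsq i x v =
  nsq j (coord j (inv_coord i x)) (v *m transition_jacobian i j x).
Proof. by move=> ox; rewrite /bil (gmx_transition g ox) trmx_mul !mulmxA. Qed.

Lemma flat_change i j x v : overlap i j x -> flat i x v =
  flat j (coord j (inv_coord i x)) (v *m transition_jacobian i j x)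
    *m (transition_jacobian i j x)^T.
Proof. by move=> ox; rewrite (gmx_transition g ox) !mulmxA. Qed.

(** The chart chosen in [speed] may jump along the curve; by the transition rule of the metric every
    chart gives the same value. *)
Lemma speed_chart i gam s v : {for s, continuous gam} -> dom i (gam s) ->
  is_derive s 1 (coord i \o gam) v ->
  speed g gam s = Num.sqrt (nsq i (coord i (gam s)) v).
Proof.
move=> gc is_ cd; rewrite /speed derive1E.
have js := dom_chart_at A (gam s).
have [_ ->] := velocity_change gc is_ js cd.
by rewrite -/(bil _ _ _) (nsq_change v (overlap_coord is_ js)) coordK.
Qed.

Lemma nsq_derive (V : normedModType R) i (c : V -> 'rV[R]_n) (u : V -> 'rV[R]_n)
    (s e : V) c' u' : img i (c s) ->
  is_derive s e c c' -> is_derive s e u u' ->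
  is_derive s e (fun t => nsq i (c t) (u t))
    (2 * bil (gmx g i (c s)) u' (u s) + bil (dgmx i (c s) c') (u s) (u s)).
Proof.
move=> ic cd ud.
have Gd := gmx_derive ic cd.
have /is_derive_mxP /(_ 0 0) := is_derive_mulmx (is_derive_mulmx ud Gd) (is_derive_trmx ud).
congr (is_derive _ _ _ _); rewrite mxE mulmxDl mxE -!/(bil _ _ _).
rewrite (bilC (u s) u' (gmx_sym g ic)); ring.
Qed.

(** Differentiate the invariance of the kinetic energy in [x] at fixed [v]. As the velocity seen in
    chart [j] depends on [x] through the Jacobian, a second-derivative term appears; by its symmetry
    it is the term that also arises in the derivative of the transported momentum. *)
Lemma force_change i j x v : overlap i j x -> force i x v =
  (v *m transition_jacobian i j x) *m gmx g j (coord j (inv_coord i x))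
    *m (djacobian i j x v)^T +
  force j (coord j (inv_coord i x)) (v *m transition_jacobian i j x)
    *m (transition_jacobian i j x)^T.
Proof.
move=> ox; apply/rowP => l.
pose e : 'rV[R]_n := delta_mx 0 l.
have idd : is_derive x e id e by exact: is_derive_id.
have cd := transition_derive ox idd.
have Jd := jacobian_derive ox idd.
have jx : img j (coord j (inv_coord i x)).
  by apply: img_coord; exact: overlap_dom ox.
have vd : is_derive x e (fun y => v *m transition_jacobian i j y) (v *m djacobian i j x e).
  have := is_derive_mulmx (is_derive_cst v x e) Jd.
  by rewrite mul0mx add0r.
have H1 := nsq_derive jx cd vd.
have H2 := @nsq_derive _ i id (cst v) x e e 0 (overlap_img ox) idd (is_derive_cst _ _ _).
have : is_derive x e (fun y => nsq i y v)
    (2 * bil (gmx g j (coord j (inv_coord i x))) (v *m djacobian i j x e)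
           (v *m transition_jacobian i j x) +
     bil (dgmx j (coord j (inv_coord i x)) (e *m transition_jacobian i j x))
       (v *m transition_jacobian i j x) (v *m transition_jacobian i j x)).
  apply: near_eq_is_derive H1.
  have : \forall y \near x, overlap i j y.
    by apply: open_nbhs_nbhs; split; [exact: overlap_open|].
  by apply: filterS => y oy; rewrite (nsq_change v oy).
move=> /(is_derive_unique H2) E.
rewrite [LHS]mxE; move: E; rewrite {1}/bil mul0mx mul0mx mxE mulr0 add0r => ->.
rewrite [RHS]mxE mulrDr mulrA mulVf ?mul1r//; congr (_ + _).
  rewrite (djacobianC v e ox) bilC ?gmx_sym//.
  by rewrite /bil trmx_mul !mulmxA trmx_delta -colE [LHS]mxE.
rewrite -force_sum [RHS]mxE; apply: eq_bigr => m _.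
by rewrite mulrC -rowE; congr (_ * _); rewrite !mxE.
Qed.

End metric.

(** * The geodesic equation in Euler-Lagrange form *)

Section geodesics.
Variables (R : realType) (n : nat) (M : topologicalType) (A : smooth_atlas R n M).
Variable g : riemannian_metric A.
Implicit Types (i j : chart A) (p : M) (x v w q : 'rV[R]_n) (gam : R -> M).

Notation flat i x v := (v *m gmx g i x).

Lemma flat_derive i (c v : R -> 'rV[R]_n) s q : img i (c s) ->
  is_derive s 1 c (v s) -> is_derive s 1 v q ->
  is_derive s 1 (fun t => flat i (c t) (v t))
    (q *m gmx g i (c s) + v s *m dgmx g i (c s) (v s)).
Proof.
by move=> ic cd vd; apply: is_derive_mulmx => //; exact: gmx_derive.
Qed.

Lemma invmx_gmx_sym i x : img i x -> (invmx (gmx g i x))^T = invmx (gmx g i x).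
Proof. by move=> ix; rewrite trmx_inv gmx_sym. Qed.

(** Contracted twice with [v], the first two terms of a Christoffel symbol agree by exchanging
    indices and add up to the derivative of the metric along [v]; the third one is the force. *)
Lemma christoffel_force i x v (k : 'I_n) : img i x ->
  \sum_(p < n) \sum_(q < n) christoffel g i k p q x * v 0 p * v 0 q =
  ((v *m dgmx g i x v - force g i x v) *m invmx (gmx g i x)) 0 k.
Proof.
move=> ix; rewrite mxE.
pose D (l a b : 'I_n) := partial l (fun y => gmx g i y a b) x.
have DC l a b : D l a b = D l b a.
  apply: near_eq_derive.
  have : \forall y \near x, img i y by apply: open_nbhs_nbhs; split; [exact: img_openE|].
  by apply: filterS => y iy; rewrite -[in LHS](gmx_sym g iy) mxE.
have Wl l : (v *m dgmx g i x v - force g i x v) 0 l =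
    2^-1 * \sum_p \sum_q (D p l q + D q l p - D l p q) * (v 0 p * v 0 q).
  have E1 : (v *m dgmx g i x v) 0 l = \sum_p \sum_q D p l q * (v 0 p * v 0 q).
    rewrite mxE exchange_big/=; apply: eq_bigr => b _.
    rewrite mxE mulr_sumr; apply: eq_bigr => p _.
    by rewrite -/(D p b l) DC mulrCA (mulrC (v 0 p)).
  have E2 : (v *m dgmx g i x v) 0 l = \sum_p \sum_q D q l p * (v 0 p * v 0 q).
    rewrite E1 exchange_big/=; apply: eq_bigr => p _; apply: eq_bigr => q _.
    by rewrite (mulrC (v 0 p)).
  have E3 : bil (dgmx g i x (delta_mx 0 l)) v v = \sum_p \sum_q D l p q * (v 0 p * v 0 q).
    rewrite bilE; apply: eq_bigr => p _; apply: eq_bigr => q _.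
    rewrite mxE (bigD1 l)//= mxE !eqxx mulr1 big1 ?addr0 ?mulrA// => c cl.
    by rewrite mxE (negbTE cl) andbF mulr0.
  rewrite mxE [X in _ + X]mxE [X in _ - X]mxE E3.
  have -> : \sum_p \sum_q (D p l q + D q l p - D l p q) * (v 0 p * v 0 q) =
      \sum_p \sum_q D p l q * (v 0 p * v 0 q) + \sum_p \sum_q D q l p * (v 0 p * v 0 q)
      - \sum_p \sum_q D l p q * (v 0 p * v 0 q).
    rewrite -big_split -sumrB/=; apply: eq_bigr => p _.
    rewrite -big_split -sumrB/=; apply: eq_bigr => q _.
    by rewrite mulrBl mulrDl.
  by rewrite -E1 -E2; field.
under [RHS]eq_bigr => l _ do
  rewrite Wl -[invmx (gmx g i x)](invmx_gmx_sym ix) mxE mulr_sumr mulr_suml.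
under [RHS]eq_bigr do under eq_bigr do rewrite mulr_sumr mulr_suml.
rewrite [RHS]exchange_big/=; apply: eq_bigr => p _.
rewrite [RHS]exchange_big/=; apply: eq_bigr => q _.
rewrite /christoffel mulr_sumr !mulr_suml; apply: eq_bigr => l _.
rewrite -!/(D _ _ _); ring.
Qed.

(** The Euler-Lagrange equation solved for the acceleration. *)
Definition geodesic_field i x v : 'rV[R]_n :=
  (force g i x v - v *m dgmx g i x v) *m invmx (gmx g i x).

Lemma geodesic_field_flat i x v : img i x ->
  geodesic_field i x v *m gmx g i x + v *m dgmx g i x v = force g i x v.
Proof.
by move=> ix; rewrite /geodesic_field mulmxKV ?gmx_unit// subrK.
Qed.

Lemma geodesic_equation i x v q (k : 'I_n) : img i x ->
  q *m gmx g i x + v *m dgmx g i x v = force g i x v ->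
  q 0 k + \sum_(a < n) \sum_(b < n) christoffel g i k a b x * v 0 a * v 0 b = 0.
Proof.
move=> ix E; rewrite christoffel_force//.
have -> : v *m dgmx g i x v - force g i x v = - (q *m gmx g i x).
  by rewrite -E opprD addrCA subrr addr0.
by rewrite mulNmx mulmxK ?gmx_unit// mxE subrr.
Qed.

(** Momentum and force transform compatibly, so a curve that solves the equation in the single chart
    [i] solves it in every chart [j], as [is_geodesic] demands. *)
Lemma geodesic_chart i j gam (v : R -> 'rV[R]_n) (s : R) :
  (\forall t \near s, {for t, continuous gam}) -> dom i (gam s) -> dom j (gam s) ->
  (\forall t \near s, is_derive (t : R) 1 (coord i \o gam) (v t)) ->
  is_derive s 1 v (geodesic_field i (coord i (gam s)) (v s)) ->
  let c := coord j \o gam in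
  [/\ derivable c s 1, derivable (derive1 c) s 1 &
    forall k : 'I_n, derive1 (derive1 c) s 0 k +
      \sum_(p < n) \sum_(q < n)
        christoffel g j k p q (c s) * derive1 c s 0 p * derive1 c s 0 q = 0].
Proof.
move=> gcn is_ js cdn vd c.
have gc := nbhs_singleton gcn; have cd := nbhs_singleton cdn.
have osi := overlap_coord is_ js; have osj := overlap_coord js is_.
have ijn := near_dom gc js; have iin := near_dom gc is_.
pose vj t := v t *m transition_jacobian i j (coord i (gam t)).
have cdj : is_derive s 1 c (vj s) by exact: velocity_change.
(* Equality near [s], not only at [s], because [derive1 c] is about to be differentiated. *)
have vjE : \forall t \near s, vj t = derive1 c t.
  near=> t; rewrite derive1E.
  by have [_ ->] : is_derive t 1 c (vj t); [apply: velocity_change; near: t|].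
have Jd := jacobian_derive osi cd.
have vjd := is_derive_mulmx vd Jd.
have vjd' := near_eq_is_derive vjE vjd.
have dcs : derive1 c s = vj s by rewrite -(nbhs_singleton vjE).
split; [by case: cdj|by case: vjd'|].
have jcs : img j (c s) by exact: img_coord.
pose F t := flat j (c t) (vj t).
have F1 := flat_derive jcs cdj vjd.
(* The momentum in chart [j], computed from chart [i]. Differentiating it in both forms yields the
   equation in chart [j]. *)
pose H t := flat i (coord i (gam t)) (v t) *m (transition_jacobian j i (c t))^T.
have back : \forall t \near s,
    v t = vj t *m transition_jacobian j i (c t) /\
    coord i (inv_coord j (c t)) = coord i (gam t).
  near=> t.
  have it : dom i (gam t) by near: t.
  have jt : dom j (gam t) by near: t.
  have ct : {for t, continuous gam} by near: t.
  have d1 : is_derive t 1 (coord i \o gam) (v t) by near: t.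
  split; last by rewrite /c/= coordK.
  apply: (is_derive_unique d1); apply: velocity_change => //.
  exact: (velocity_change ct it jt d1).
have HF : \forall t \near s, H t = F t.
  near=> t; have [bv bc] : v t = vj t *m transition_jacobian j i (c t) /\
    coord i (inv_coord j (c t)) = coord i (gam t) by near: t.
  have ot : overlap j i (c t) by apply: overlap_coord; near: t.
  by rewrite /F (flat_change g (vj t) ot) bc -bv.
have ics : img i (coord i (gam s)) by exact: img_coord.
have Hd : is_derive s 1 H (force g j (c s) (vj s)).
  have := is_derive_mulmx (flat_derive ics cd vd) (is_derive_trmx (jacobian_derive osj cdj)).
  congr (is_derive _ _ _ _).
  have [bv bc] := nbhs_singleton back.
  by rewrite geodesic_field_flat// (force_change g (vj s) osj) bc -bv addrC.
have E := is_derive_unique F1 (near_eq_is_derive HF Hd).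
move=> k; rewrite dcs derive1E; have [_ ->] := vjd'.
exact: geodesic_equation E.
Unshelve. all: by end_near. Qed.

End geodesics.

(** * Local minimality of geodesics *)

Section dot_product.
Variables (R : realType) (n : nat).
Implicit Types (G : 'M[R]_n) (u v w : 'rV[R]_n).

Definition dot u w : R := (u *m w^T) 0 0.

Lemma dotE u w : dot u w = \sum_a u 0 a * w 0 a.
Proof. by rewrite /dot mxE; apply: eq_bigr => a _; rewrite mxE. Qed.

Lemma dotDl u v w : dot (u + v) w = dot u w + dot v w.
Proof. by rewrite /dot mulmxDl mxE. Qed.

Lemma dotDr u v w : dot w (u + v) = dot w u + dot w v.
Proof. by rewrite /dot linearD/= mulmxDr mxE. Qed.

Lemma dotZl k u w : dot (k *: u) w = k * dot u w.
Proof. by rewrite /dot -scalemxAl mxE. Qed.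

Lemma dotZr k u w : dot u (k *: w) = k * dot u w.
Proof. by rewrite /dot linearZ/= -scalemxAr mxE. Qed.

Lemma dotC u w : dot u w = dot w u.
Proof. by rewrite !dotE; apply: eq_bigr => a _; rewrite mulrC. Qed.

Lemma dot0r u : dot u 0 = 0.
Proof. by rewrite /dot trmx0 mulmx0 mxE. Qed.

Lemma dot_mulmx G u w : dot (u *m G) w = bil G u w.
Proof. by []. Qed.

Lemma dot_le u w : `|dot u w| <= n%:R * `|u| * `|w|.
Proof.
rewrite dotE (le_trans (ler_norm_sum _ _ _))//.
rewrite (@le_trans _ _ (\sum_(a < n) (`|u| * `|w|)))//.
  apply: ler_sum => a _; rewrite normrM.
  by apply: ler_pM => //; exact: coord_le_norm.
by rewrite sumr_const card_ord -[leLHS]mulr_natl mulrA.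
Qed.

Lemma sqr_norm_le_dot w : `|w| ^+ 2 <= dot w w.
Proof.
have d0 : 0 <= dot w w by rewrite dotE sumr_ge0// => a _; rewrite -expr2 sqr_ge0.
rewrite -(sqr_sqrtr d0) ler_sqr ?nnegrE ?sqrtr_ge0//.
apply: rV_norm_le => [|a]; first exact: sqrtr_ge0.
rewrite -sqrtr_sqr ler_sqrt// dotE (bigD1 a)//= expr2 lerDl.
by apply: sumr_ge0 => b _; rewrite -expr2 sqr_ge0.
Qed.

Lemma bil_continuous G : continuous (fun u => bil G u u).
Proof.
move=> u; rewrite (_ : (fun u => bil G u u) =
   fun u => \sum_a \sum_b G a b * u 0 a * u 0 b); last first.
  by apply/funext => w; rewrite bilE.
rewrite /continuous_at.
have uc (a : 'I_n) : (fun x : 'rV[R]_n => x 0 a) @ u --> u 0 a.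
  exact: matrix_normedtype.coord_continuous.
apply: (@cvg_sumr _ _ _ _ _ _ _ (nbhs_filter u)) => a.
apply: (@cvg_sumr _ _ _ _ _ _ _ (nbhs_filter u)) => b.
apply: (@cvgM _ _ _ (nbhs_filter u) _ _ _ _ _ (uc b)).
by apply: (@cvgM _ _ _ (nbhs_filter u) _ _ _ _ _ (uc a)); exact: cvg_cst.
Qed.

(** The constant is the minimum of the form over the compact unit sphere of the sup norm; an empty
    sphere means that 0 is the only vector. *)
Lemma posdef_lower G : (forall u, u != 0 -> 0 < bil G u u) ->
  exists2 m : R, 0 < m & forall u, m * `|u| ^+ 2 <= bil G u u.
Proof.
move=> Gpos; pose S := [set u : 'rV[R]_n | `|u| = 1].
have [[e Se]|S0] := pselect (exists u, S u); last first.
  exists 1 => // u; have [->|u0] := eqVneq u 0.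
    by rewrite normr0 expr0n/= mulr0 /bil !mul0mx mxE.
  exfalso; apply: S0; exists (`|u|^-1 *: u).
  by rewrite /S/= normrZ normfV normr_id mulVf// normr_eq0.
have Sc : compact S.
  apply: bounded_closed_compact.
    by exists 1; split => // x x1 y /= ->; exact: ltW.
  apply: (@closed_comp _ _ (fun u : 'rV[R]_n => `|u|) [set x | x = 1]).
    by move=> x _; exact: norm_continuous.
  exact: closed_eq.
have [||c cS Hc] := @EVT_min_rV R n (fun u => bil G u u) S _ Sc.
- by exists e.
- exact/continuous_subspaceT/bil_continuous.
rewrite inE in cS; have c0 : c != 0 by rewrite -normr_eq0 cS oner_eq0.
exists (bil G c c) => [|u]; first exact: Gpos.
have [->|u0] := eqVneq u 0.
  by rewrite normr0 expr0n/= mulr0 /bil !mul0mx mxE.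
have u1 : 0 < `|u| by rewrite normr_gt0.
have : bil G c c <= bil G (`|u|^-1 *: u) (`|u|^-1 *: u).
  apply: Hc; rewrite inE /S/= normrZ normfV normr_id mulVf//.
  by rewrite gt_eqF.
by rewrite bilZl bilZr mulrA -invfM -expr2 mulrC ler_pdivlMr ?exprn_gt0.
Qed.

End dot_product.

Lemma is_derive_comp1 (R : realType) (V W : normedModType R) (tau : V -> R)
    (f : R -> W) (s e : V) (t' : R) (f' : W) :
  is_derive s e tau t' -> is_derive (tau s) 1 f f' ->
  is_derive s e (f \o tau) (t' *: f').
Proof.
move=> td [fd fE].
have fdiff : is_diff (tau s) f (fun h => h *: f').
  have /derivable1_diffP fd' := fd.
  by split=> //; rewrite diff1E// derive1E fE.
exact: is_derive_diff_comp td fdiff.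
Qed.

(** * Local bounds on the metric and the eikonal inequality *)

Section local_bounds.
Variables (R : realType) (n : nat) (M : topologicalType) (A : smooth_atlas R n M).
Variable g : riemannian_metric A.
Implicit Types (i j : chart A) (x y z v w u : 'rV[R]_n).

Lemma metric_bounds i x : img i x -> exists m r K : R,
  [/\ 0 < m, 0 < r, 0 <= K, forall z, `|z - x| < r -> img i z &
    [/\ forall z u, `|z - x| < r -> m * `|u| ^+ 2 <= bil (gmx g i z) u u,
        forall y z a b, `|y - x| < r -> `|z - x| < r ->
          `|(gmx g i z - gmx g i y) a b| <= K * `|z - y| &
        forall y z a b, `|y - x| < r -> `|z - x| < r ->
          `|(gmx g i z - gmx g i y - dgmx g i y (z - y)) a b| <= K * `|z - y| ^+ 2]].
Proof.
move=> ix.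
have [m m0 Hm] := posdef_lower (fun u => @gmx_pos _ _ _ _ g i x u ix).
have [r1 r10 H1] := open_ball_sub (@img_openE _ _ _ A i) ix.
have [K2 K20 [r2 r20 H2]] : exists2 k : R, 0 <= k &
  exists2 r : R, 0 < r & forall (ab : 'I_n * 'I_n) y z, `|y - x| < r -> `|z - x| < r ->
    `|gmx g i z ab.1 ab.2 - gmx g i y ab.1 ab.2| <= k * `|z - y|.
  apply: (@lip_near_family _ _ _ (fun ab z => gmx g i z ab.1 ab.2)) => -[a b].
  exact: (C1_lip_near (@img_openE _ _ _ A i) ix (@gmx_C _ _ _ _ g i a b 1)).
have /choice[kr Hkr] (ab : 'I_n * 'I_n) : exists kr : R * R, [/\ 0 <= kr.1, 0 < kr.2 &
    forall y z, `|y - x| < kr.2 -> `|z - x| < kr.2 ->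
    `|(gmx g i z - gmx g i y - dgmx g i y (z - y)) ab.1 ab.2| <= kr.1 * `|z - y| ^+ 2].
  have [k k0 [r r0 H]] := C2_taylor (@img_openE _ _ _ A i) ix (@gmx_C _ _ _ _ g i ab.1 ab.2 2).
  exists (k, r); split => // y z yr zr /=.
  have := H y z yr zr; congr (`|_| <= _); rewrite !mxE; congr (_ - _).
  by apply: eq_bigr => c _; rewrite !mxE.
pose K3 := \sum_ab (kr ab).1.
have K30 : 0 <= K3 by apply: sumr_ge0 => ab _; have [] := Hkr ab.
pose r3 := \big[Num.min/1]_ab (kr ab).2.
have r30 : 0 < r3 by apply/bigmin_gtP; split => // ab _; have [] := Hkr ab.
pose K := K2 + K3.
pose N : R := n%:R ^+ 2 * K.
have N0 : 0 <= N by rewrite mulr_ge0 ?sqr_ge0// addr_ge0.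
(* Within this radius the form changes by at most [m / 2 * |u|^2], which leaves half of the lower
   bound found at [x]. *)
pose r4 := m / (2 * (N + 1)).
have N1 : 0 < N + 1 by rewrite ltr_wpDl.
have r40 : 0 < r4 by rewrite divr_gt0// mulr_gt0.
exists (m / 2), (Num.min (Num.min r1 r2) (Num.min r3 r4)), K; split.
- by rewrite divr_gt0.
- by rewrite !lt_min r10 r20 r30.
- by rewrite addr_ge0.
- by move=> z; rewrite !lt_min => /andP[/andP[zr _] _]; exact: H1.
split.
- move=> z u; rewrite !lt_min => /andP[/andP[_ zr2] /andP[_ zr4]].
  have := Hm u.
  have -> : bil (gmx g i z) u u = bil (gmx g i x) u u + bil (gmx g i z - gmx g i x) u u.
    by rewrite -bilD addrC subrK.
  have : `|bil (gmx g i z - gmx g i x) u u| <= n%:R ^+ 2 * (K * `|z - x|) * `|u| * `|u|.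
    apply: bil_le => [|a b]; first by rewrite mulr_ge0// addr_ge0.
    have := H2 (a, b) x z _ zr2; rewrite subrr normr0 => /(_ r20)/= H.
    by rewrite !mxE (le_trans H)// ler_wpM2r// lerDl.
  have : n%:R ^+ 2 * (K * `|z - x|) * `|u| * `|u| <= m / 2 * `|u| ^+ 2.
    rewrite [`|u| ^+ 2]expr2 (mulrA (m / 2)) (mulrA (n%:R ^+ 2)) -/N.
    rewrite ler_wpM2r// ler_wpM2r//.
    rewrite (@le_trans _ _ ((N + 1) * r4))//.
      by rewrite ler_pM// ?lerDl// ltW.
    by rewrite (_ : (N + 1) * r4 = m / 2)// /r4; field; rewrite gt_eqF.
  rewrite ler_norml; move: (n%:R ^+ 2 * _ * _ * _) (bil _ _ _) (bil _ _ _) (`|u| ^+ 2).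
  by clear; move=> X Y Z U ? /andP[? ?] ?; lra.
- move=> y z a b; rewrite !lt_min => /andP[/andP[_ yr2] _] /andP[/andP[_ zr2] _].
  rewrite !mxE (le_trans (H2 (a, b) y z yr2 zr2))//.
  by rewrite ler_wpM2r// lerDl.
- move=> y z a b; rewrite !lt_min => /andP[_ /andP[yr3 _]] /andP[_ /andP[zr3 _]].
  have [k0 s0 Hab] := Hkr (a, b).
  have le3 : r3 <= (kr (a, b)).2 by exact: bigmin_le.
  apply: (le_trans (Hab y z (lt_le_trans yr3 le3) (lt_le_trans zr3 le3))).
  rewrite ler_wpM2r ?sqr_ge0// /K /K3 (bigD1 (a, b))//=.
  rewrite addrCA lerDl addr_ge0// sumr_ge0// => ab _.
  by have [] := Hkr ab.
Qed.

(** Complete the square [(m * h - N * s) ^+ 2 / (2 * m)]. In the application [s] is the distance to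
    the geodesic and [h] the deviation from its velocity; the cross term is paid by the ellipticity
    of the metric in [h] and by [k] in [s]. *)
Lemma quadratic_absorb (m N L s h k : R) : 0 < m -> 0 <= s -> 0 <= h ->
  N ^+ 2 / m + L <= k ->
  0 <= - (L / 2 * s ^+ 2) - N * s * h + m / 2 * h ^+ 2 + k / 2 * s ^+ 2.
Proof.
move=> m0 s0 h0 kN.
have : (N ^+ 2 / m + L) / 2 * s ^+ 2 <= k / 2 * s ^+ 2.
  by rewrite ler_wpM2r ?sqr_ge0// ler_pM2r ?invr_gt0.
have : 0 <= (m * h - N * s) ^+ 2 / (2 * m) by rewrite divr_ge0 ?sqr_ge0// mulr_ge0// ltW.
have -> : (m * h - N * s) ^+ 2 / (2 * m) =
   m / 2 * h ^+ 2 - N * s * h + N ^+ 2 / m / 2 * s ^+ 2 by field; rewrite gt_eqF.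
by lra.
Qed.

(* The eikonal subsolution inequality for the calibration below: the first two
   order terms in [z - y] cancel by the geodesic equation, the quadratic one is
   absorbed by the concave term of size [k]. *)
Lemma calibration_le i (m K B k a : R) y z v u :
  0 < m -> 0 <= K -> 0 <= B -> `|v| <= B -> 0 <= a <= 1 ->
  img i y -> img i z -> bil (gmx g i y) v v = 1 ->
  (forall h, m * `|h| ^+ 2 <= bil (gmx g i z) h h) ->
  (forall b c, `|(gmx g i z - gmx g i y) b c| <= K * `|z - y|) ->
  (forall b c, `|(gmx g i z - gmx g i y - dgmx g i y (z - y)) b c| <= K * `|z - y| ^+ 2) ->
  (n%:R ^+ 2 * K * B + n%:R) ^+ 2 / m + n%:R ^+ 2 * K * B ^+ 2 <= k ->
  dot (force g i y v) (z - y) - dot (v *m gmx g i y) v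
    - k / 2 * dot (z - y) (z - y) + a * dot (z - y) v
    + (dot (v *m gmx g i y) u - a * dot (z - y) u)
  <= 2^-1 * bil (gmx g i z) u u - 2^-1.
Proof.
move=> m0 K0 B0 vB /andP[a0 a1] iy iz v1 Hm HK HT Hk.
set w := z - y in HK HT *; clearbody w.
have [h ->] : exists h, u = v + h by exists (u - v); rewrite addrC subrK.
pose Gy := gmx g i y; pose Gz := gmx g i z.
pose D := Gz - Gy; pose T := Gz - Gy - dgmx g i y w.
have Ew : dot (force g i y v) w = 2^-1 * bil (dgmx g i y w) v v.
  rewrite -force_sum dotE; apply: eq_bigr => l _; exact: mulrC.
have Ez p q : bil Gz p q = bil Gy p q + bil D p q.
  by rewrite -bilD /D addrC subrK.
have EzT p q : bil Gz p q = bil Gy p q + bil (dgmx g i y w) p q + bil T p q.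
  by rewrite -!bilD /T -(addrA Gz) -opprD [_ + (Gz - _)]addrC subrK.
rewrite Ew !dot_mulmx -/Gy -/Gz !dotDr !bilDl !bilDr v1.
rewrite (bilC h v (gmx_sym g iz) : bil Gz h v = bil Gz v h).
rewrite (EzT v v) (Ez v h) v1.
have T1 : `|bil T v v| <= n%:R ^+ 2 * K * B ^+ 2 * `|w| ^+ 2.
  apply: (le_trans (bil_le v v _ HT)); first by rewrite mulr_ge0 ?sqr_ge0.
  rewrite [leLHS](_ : _ = n%:R ^+ 2 * K * `|w| ^+ 2 * (`|v| * `|v|)); last by ring.
  rewrite [leRHS](_ : _ = n%:R ^+ 2 * K * `|w| ^+ 2 * (B * B)); last by ring.
  by rewrite ler_wpM2l ?mulr_ge0 ?sqr_ge0// ler_pM.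
have D1 : `|bil D v h| <= n%:R ^+ 2 * K * B * `|w| * `|h|.
  apply: (le_trans (bil_le v h _ HK)); first by rewrite mulr_ge0.
  rewrite ler_wpM2r// [leLHS](_ : _ = n%:R ^+ 2 * K * `|w| * `|v|); last by ring.
  rewrite [leRHS](_ : _ = n%:R ^+ 2 * K * `|w| * B); last by ring.
  by rewrite ler_wpM2l ?mulr_ge0 ?sqr_ge0.
have a1' : `|a * dot w h| <= n%:R * `|w| * `|h|.
  by apply: le_trans (dot_le w h); rewrite normrM (ger0_norm a0) ler_piMl.
have := Hm h; rewrite -/Gz.
have w2 := sqr_norm_le_dot w.
have k0 : 0 <= k.
  apply: le_trans Hk; rewrite addr_ge0//; first by rewrite divr_ge0 ?sqr_ge0 ?ltW.
  by rewrite !mulr_ge0// ?sqr_ge0.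
have w3 : k / 2 * `|w| ^+ 2 <= k / 2 * dot w w by rewrite ler_wpM2l// divr_ge0.
have := quadratic_absorb m0 (normr_ge0 w) (normr_ge0 h) Hk.
move: T1 D1 a1' w3; rewrite mulrDr !ler_norml.
rewrite -[a * dot w h]/(a * dot w h).
move: (bil T v v) (bil D v h) (a * dot w h) (bil Gz h h) (dot w w)
  (bil Gy v h) (a * dot w v) (bil (dgmx g i y w) v v) => tv dh awh gh ww gvh awv dgv.
move: (`|w|) (`|h|) => sw sh.
move: (n%:R ^+ 2 * K) => NK.
have -> : NK * B ^+ 2 / 2 * sw ^+ 2 = 2^-1 * (NK * B ^+ 2 * sw ^+ 2) by field.
have -> : (NK * B + n%:R) * sw * sh = NK * B * sw * sh + n%:R * sw * sh by ring.
have -> : m / 2 * sh ^+ 2 = 2^-1 * (m * sh ^+ 2) by field.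
move: (NK * B ^+ 2 * sw ^+ 2) (NK * B * sw * sh) (n%:R * sw * sh) (m * sh ^+ 2)
  (k / 2 * sw ^+ 2) => x1 x2 x3 x4 x5.
clear => /andP[? ?] /andP[? ?] /andP[? ?] ? ? ?; lra.
Qed.

End local_bounds.

(** * Unit-speed geodesics in a chart and their calibrations *)

Section local_geodesics.
Variables (R : realType) (n : nat) (M : topologicalType) (A : smooth_atlas R n M).
Variable g : riemannian_metric A.
Implicit Types (i j : chart A) (x y z w u : 'rV[R]_n).

Lemma lsubmx_norm (z : 'rV[R]_(n + n)) : `|lsubmx z| <= `|z|.
Proof. by apply: rV_norm_le => // a; rewrite mxE coord_le_norm. Qed.

Lemma lip_near_lsubmx (f : 'rV[R]_n -> R) x y :
  lip_near f x -> lip_near (fun z : 'rV[R]_(n + n) => f (lsubmx z)) (row_mx x y).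
Proof.
move=> fl; apply: (@lip_near_comp _ _ _ lsubmx 1); last by rewrite row_mxKl.
by move=> a b; rewrite mul1r -linearB/= lsubmx_norm.
Qed.

Lemma lip_near_rsubmx x y (a : 'I_n) :
  lip_near (fun z : 'rV[R]_(n + n) => rsubmx z 0 a) (row_mx x y).
Proof.
exists 1 => //; exists 1 => // y1 z _ _; rewrite mul1r !mxE.
by have := coord_le_norm (z - y1) (rshift n a); rewrite !mxE.
Qed.

(** The field is polynomial in the velocity, with coefficients built from the inverse metric and the
    first derivatives of the metric, which are locally Lipschitz. *)
Lemma geodesic_field_lip i x y (a : 'I_n) : img i x ->
  lip_near (fun z : 'rV[R]_(n + n) => geodesic_field g i (lsubmx z) (rsubmx z) 0 a)
    (row_mx x y).
Proof.
move=> ix.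
have Gl (b c : 'I_n) : lip_near (fun z => gmx g i z b c) x.
  exact: (C1_lip_near (@img_openE _ _ _ A i) ix (@gmx_C _ _ _ _ g i b c 1)).
have dGl (l b c : 'I_n) : lip_near (partial l (fun z => gmx g i z b c)) x.
  have [_ /(_ l)[_ C1]] := @gmx_C _ _ _ _ g i b c 2.
  exact: (C1_lip_near (@img_openE _ _ _ A i) ix C1).
have [r r0 rU] := open_ball_sub (@img_openE _ _ _ A i) ix.
have Il : forall b c, lip_near (fun z => invmx (gmx g i z) b c) x.
  by apply: lip_near_invmx => //; exists r => // z zr; apply: gmx_unit; exact: rU.
rewrite (_ : (fun t => _) = fun z : 'rV[R]_(n + n) =>
  \sum_l (2^-1 * (\sum_b \sum_c (partial l (fun y => gmx g i y b c) (lsubmx z)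
      * rsubmx z 0 b * rsubmx z 0 c))
   + (-1) * \sum_b rsubmx z 0 b *
      \sum_c partial c (fun y => gmx g i y b l) (lsubmx z) * rsubmx z 0 c)
   * invmx (gmx g i (lsubmx z)) l a); last first.
  apply/funext => z; rewrite mxE; apply: eq_bigr => l _; congr (_ * _).
  rewrite mxE [X in X + _]mxE [X in _ + X]mxE bilE mulN1r; congr (_ * _ - _).
    apply: eq_bigr => b _; apply: eq_bigr => c _; congr (_ * _ * _).
    rewrite mxE (bigD1 l)//= mxE !eqxx mulr1 big1 ?addr0// => k kl.
    by rewrite mxE (negbTE kl) andbF mulr0.
  by rewrite [LHS]mxE; apply: eq_bigr => b _; congr (_ * _); rewrite mxE.
apply: lip_near_sum => l _; apply: lip_nearM; last first.
  exact: (@lip_near_lsubmx (fun z => invmx (gmx g i z) l a)).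
apply: lip_nearD; apply: lip_nearM; do ?exact: lip_near_cst.
  apply: lip_near_sum => b _; apply: lip_near_sum => c _.
  apply: lip_nearM; last exact: lip_near_rsubmx.
  by apply: lip_nearM; [exact: lip_near_lsubmx|exact: lip_near_rsubmx].
apply: lip_near_sum => b _; apply: lip_nearM; first exact: lip_near_rsubmx.
apply: lip_near_sum => c _; apply: lip_nearM; last exact: lip_near_rsubmx.
exact: lip_near_lsubmx.
Qed.

Lemma local_geodesic i x (v0 : 'rV[R]_n) : img i x -> bil (gmx g i x) v0 v0 = 1 ->
  exists2 d : R, 0 < d & exists c v : R -> 'rV[R]_n, [/\ c 0 = x, v 0 = v0 &
    forall t : R, `|t| < d -> [/\ img i (c t), is_derive t 1 c (v t),
      is_derive t 1 v (geodesic_field g i (c t) (v t)) &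
      bil (gmx g i (c t)) (v t) (v t) = 1]].
Proof.
move=> ix v1.
have [d d0 [c [v [c0 v0E cv]]]] :=
  local_ode2 (fun a => @geodesic_field_lip i x v0 a ix).
have [r r0 rI] := open_ball_sub (@img_openE _ _ _ A i) ix.
have cc : {for 0, continuous c}.
  have d00 : `|0 : R| < d by rewrite normr0.
  exact: is_derive1_continuous (cv 0 d00).1.
have [e e0 ce] : exists2 e : R, 0 < e & forall t : R, `|t| < e -> img i (c t).
  have : \forall t \near (0 : R), img i (c t).
    by apply: cc; rewrite c0; apply: open_nbhs_nbhs; split; [exact: img_openE|].
  move=> /nbhs_ballP[e /= e0 H]; exists e => // t te.
  by apply: H; rewrite /ball/= sub0r normrN.
exists (Num.min d e); first by rewrite lt_min d0.
exists c, v; split => // t; rewrite lt_min => /andP[td te].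
have [cd vd] := cv t td; split => //; first exact: ce.
rewrite -v1 -c0 -v0E; apply/eqP; rewrite -subr_eq0 -normr_le0 -[leRHS](mul0r `|t - 0|).
apply: (@dist_le_derive _ (fun t => bil (gmx g i (c t)) (v t) (v t)) (fun=> 0)); last first.
  by move=> s _; rewrite normr0.
move=> s st; have [sd se] : `|s| < d /\ `|s| < e.
  move: td te st; rewrite !ltr_norml => /andP[? ?] /andP[? ?].
  by case: (leP 0 t) => ? /andP[? ?]; split; apply/andP; split; lra.
have [csd vsd] := cv s sd.
(* Conservation of energy: the Euler-Lagrange equation paired with the velocity makes the derivative
   of |v|^2 vanish. *)
have := nsq_derive g (ce s se) csd vsd; congr (is_derive _ _ _ _).
have := geodesic_field_flat g (v s) (ce s se).
move=> /(congr1 (fun X => dot X (v s))); rewrite dotDl !dot_mulmx.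
rewrite [RHS]dotC [RHS]dotE force_sum; lra.
Qed.

(** The last clause has two uses: with clock [tau] equal to arc length, [F] cannot increase along a
    curve; with the position at rest and [tau] running at unit rate, it strictly decreases. *)
Lemma calibration i x (v0 : 'rV[R]_n) : img i x -> bil (gmx g i x) v0 v0 = 1 ->
  exists (c v : R -> 'rV[R]_n) (d r m : R) (F : R -> 'rV[R]_n -> R),
  [/\ [/\ 0 < d, 0 < r & 0 < m], [/\ c 0 = x & v 0 = v0],
      forall t : R, `|t| < d -> [/\ img i (c t), is_derive t 1 c (v t),
        is_derive t 1 v (geodesic_field g i (c t) (v t)),
        bil (gmx g i (c t)) (v t) (v t) = 1 & `|c t - x| < r /\ F t (c t) = 0],
      forall z, `|z - x| < r -> img i z /\
        forall u, m * `|u| <= Num.sqrt (bil (gmx g i z) u u) &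
      forall (tau : R -> R) (zeta : R -> 'rV[R]_n) (s t' : R) u,
        is_derive s 1 tau t' -> is_derive s 1 zeta u ->
        0 <= tau s -> tau s < d -> `|zeta s - x| < r ->
        exists2 D, is_derive s 1 (fun s => F (tau s) (zeta s)) D &
          (t' = Num.sqrt (bil (gmx g i (zeta s)) u u) -> D <= 0) /\
          (t' = 1 -> u = 0 -> D < 0)].
Proof.
move=> ix v1.
have [m [r [K [m0 r0 K0 rI [Hm HK HT]]]]] := metric_bounds g ix.
have [d1 d10 [c [v [c0 v0E cv]]]] := local_geodesic ix v1.
pose B := `|v0| + 1.
have B0 : 0 <= B by rewrite addr_ge0.
(* The threshold of [calibration_le], with [B] a bound on the velocity; it does not depend on the
   time interval chosen below. *)
pose k := (n%:R ^+ 2 * K * B + n%:R) ^+ 2 / m + n%:R ^+ 2 * K * B ^+ 2.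
have k0 : 0 <= k.
  rewrite addr_ge0//; first by rewrite divr_ge0 ?sqr_ge0 ?ltW.
  by rewrite !mulr_ge0// ?sqr_ge0.
have d00 : `|0 : R| < d1 by rewrite normr0.
have [_ cd0 vd0 _] := cv 0 d00.
have [d2 d20 cvB] : exists2 e : R, 0 < e & forall t : R, `|t| < e ->
    `|c t - x| < r /\ `|v t| <= B.
  have /cvgrPdist_lt /(_ _ r0) cc := is_derive1_continuous cd0.
  have /cvgrPdist_lt /(_ _ ltr01) vc := is_derive1_continuous vd0.
  have : \forall t \near (0 : R), `|c 0 - c t| < r /\ `|v 0 - v t| < 1.
    by near=> t; split; near: t.
  move=> /nbhs_ballP[e /= e0 H]; exists e => // t te.
  have /H : ball 0 e t by rewrite /ball/= sub0r normrN.
  rewrite c0 v0E => -[h1 h2]; split; first by rewrite distrC.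
  rewrite -(subrK v0 (v t)) addrC (le_trans (ler_normD _ _))// lerD2l distrC.
  exact: ltW.
(* The last bound gives [k * t <= 1], as the coefficient [a] of [calibration_le] requires. *)
pose d := Num.min (Num.min d1 d2) (k + 1)^-1.
have k10 : 0 < k + 1 by rewrite ltr_wpDl.
have d0 : 0 < d by rewrite !lt_min d10 d20 invr_gt0.
have dP (t : R) : `|t| < d -> [/\ `|t| < d1, `|t| < d2 & `|k * t| <= 1].
  rewrite !lt_min => /andP[/andP[t1 t2] t3]; split => //.
  rewrite normrM (ger0_norm k0) (@le_trans _ _ ((k + 1) * `|t|))//.
    by rewrite ler_wpM2r// lerDl.
  by rewrite mulrC -ler_pdivlMr// mul1r ltW.
pose p t := v t *m gmx g i (c t).
pose F t z := dot (p t) (z - c t) - k / 2 * t * dot (z - c t) (z - c t).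
exists c, v, d, r, (Num.sqrt m), F; split => //.
- by split => //; rewrite sqrtr_gt0.
- move=> t /dP[t1 t2 _]; have [ct cd vd vt] := cv t t1.
  have [cB _] := cvB t t2; split=> //; split => //.
  by rewrite /F subrr !dot0r mulr0 subr0.
- move=> z zr; split; [exact: rI|move=> u].
  have -> : Num.sqrt m * `|u| = Num.sqrt (m * `|u| ^+ 2).
    by rewrite sqrtrM ?ltW// sqrtr_sqr normr_id.
  by rewrite ler_wsqrtr// Hm.
move=> tau zeta s t' u taud zetad tau0 taud' zr.
have [|t1 t2 kt1] := dP (tau s); first by rewrite ger0_norm.
have [ct cd vd vt] := cv _ t1; have [cB vB] := cvB _ t2.
have pd : is_derive (tau s) 1 p (force g i (c (tau s)) (v (tau s))).
  have := flat_derive g ct cd vd; congr (is_derive _ _ _ _).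
  exact: geodesic_field_flat.
have ptd := is_derive_comp1 taud pd.
have ctd := is_derive_comp1 taud cd.
have wd : is_derive s 1 (fun s => zeta s - c (tau s)) (u - t' *: v (tau s)).
  exact: is_deriveB.
have D1 := is_derive_mulmx ptd (is_derive_trmx wd).
have D2 := is_derive_mulmx wd (is_derive_trmx wd).
move: D1 D2 => /is_derive_mxP /(_ 0 0) D1 /is_derive_mxP /(_ 0 0) D2.
set y := c (tau s) in ct cd cB *; set w := v (tau s) in vt vB *.
set z := zeta s in zr *.
have kd : is_derive s 1 (fun s => k / 2 * tau s) (k / 2 * t').
  exact: (is_deriveZ (k / 2) taud).
(* The derivative sorted as [t'] times the time derivative of [F] plus its differential applied to
   [u], the shape of [calibration_le]. *)
pose Q := t' * (dot (force g i y w) (z - y) - dot (w *m gmx g i y) w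
    - k / 2 * dot (z - y) (z - y) + (k * tau s) * dot (z - y) w)
    + (dot (w *m gmx g i y) u - (k * tau s) * dot (z - y) u).
have FD : is_derive s 1 (fun s => F (tau s) (zeta s)) Q.
  have := is_deriveB D1 (is_deriveM kd D2); congr (is_derive _ _ _ _).
  rewrite /= mxE [X in _ - (_ *: X + _)]mxE -!/(dot _ _) /Q -/y -/w -/z.
  rewrite -[p (tau s)]/(w *m gmx g i y); move: (z - y) => e.
  rewrite (dotC (u - t' *: w)) dotZl !dotDr -!scaleNr !dotZr /GRing.scale/=.
  by field.
exists Q => //.
have calib := @calibration_le _ _ _ _ g i m K B k (k * tau s) y z w _ m0 K0 B0 vB
  (introT andP (conj (mulr_ge0 k0 tau0) (le_trans (ler_norm _) kt1))) ct (rI z zr) vt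
  (fun h => Hm z h zr) (fun b c => HK y z b c cB zr) (fun b c => HT y z b c cB zr) (lexx _).
split => [t'E|t'E u0]; last first.
  have := calib 0; rewrite /Q t'E u0 mul1r {1}/bil mul0mx mul0mx mxE mulr0 sub0r.
  by move/le_lt_trans; apply; rewrite oppr_lt0 invr_gt0.
(* For nonzero [u], apply [calibration_le] to the unit vector [u / t'], where its right-hand side
   vanishes, and multiply by [t']. *)
have [u0|u0] := eqVneq u 0; last first.
  have iz := rI z zr.
  have q0 : 0 < bil (gmx g i z) u u by exact: gmx_pos.
  have t0 : 0 < t' by rewrite t'E sqrtr_gt0.
  have := calib (t'^-1 *: u).
  have tsq : t' ^+ 2 = bil (gmx g i z) u u by rewrite t'E sqr_sqrtr// ltW.
  rewrite bilZl bilZr mulrA -invfM -expr2 tsq.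
  rewrite mulVf ?gt_eqF// mulr1 subrr !dotZr => H.
  have := ler_wpM2l (ltW t0) H; rewrite mulr0; apply: le_trans.
  rewrite le_eqVlt; apply/orP; left; apply/eqP; rewrite /Q.
  by field; rewrite gt_eqF.
have t0 : t' = 0 by rewrite t'E u0 /bil !mul0mx mxE sqrtr0.
by rewrite /Q t0 u0 mul0r add0r !dot0r mulr0 subrr.
Unshelve. all: by end_near. Qed.

End local_geodesics.

Lemma near_eq_continuous (T U : topologicalType) (f h : T -> U) (s : T) :
  (\forall t \near s, f t = h t) -> {for s, continuous f} -> {for s, continuous h}.
Proof.
move=> fh fc; rewrite /prop_for /continuous_at -(nbhs_singleton fh).
by apply: cvg_trans fc; apply: near_eq_cvg; apply: filterS fh => t ->.
Qed.

(** * Arc length of C^1 curves *)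

Section curves.
Variables (R : realType) (n : nat) (M : topologicalType) (A : smooth_atlas R n M).
Variable g : riemannian_metric A.
Implicit Types (i j : chart A) (x y z w u : 'rV[R]_n) (gam : R -> M).

(** Replaces the length integral by an arc-length function with two-sided derivatives even at the
    ends, so that later arguments only compare derivatives. *)
Lemma C1_curve_speed gam (a b : R) : a <= b -> C1_curve A gam a b ->
  exists L : R -> R, curve_length g gam a b = L b - L a /\
    forall s, a <= s <= b -> [/\ {for s, continuous gam},
      forall i, dom i (gam s) -> derivable (coord i \o gam) s 1 &
      is_derive s 1 L (speed g gam s)].
Proof.
move=> ab [e e0 H].
have sc s : a - e < s < b + e -> {for s, continuous (speed g gam)}.
  move=> se; pose j := chart_at A (gam s).
  have js : dom j (gam s) by exact: dom_chart_at.
  have [gc Hj] := H s se; have [cd vc] := Hj j js.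
  have seN : \forall t \near s, a - e < t < b + e.
    have /near_in_itvoo : s \in `]a - e, b + e[ by rewrite in_itv.
    by apply: filterS => t /=; rewrite in_itv.
  pose v := derive1 (coord j \o gam).
  pose h t := Num.sqrt (bil (gmx g j (coord j (gam t))) (v t) (v t)).
  (* Near [s] the speed is computed in the one chart [j], which removes the jumps of the chosen
     charts. *)
  apply: (@near_eq_continuous _ _ h).
    near=> t.
    have te : a - e < t < b + e by near: t.
    have jt : dom j (gam t) by near: t; exact: near_dom.
    have [gct Hjt] := H t te; have [cdt _] := Hjt j jt.
    have vd : is_derive t 1 (coord j \o gam) (v t) by rewrite /v derive1E; exact: derivableP.
    by rewrite (speed_chart g gct jt vd).
  apply: continuous_comp; last exact: sqrt_continuous.
  rewrite (_ : (fun t => _) = fun t => \sum_a \sum_b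
    gmx g j (coord j (gam t)) a b * v t 0 a * v t 0 b); last first.
    by apply/funext => t; rewrite bilE.
  have vcoord (k : 'I_n) : (fun t => v t 0 k) @ s --> v s 0 k.
    apply: (@continuous_comp _ _ _ v (fun w : 'rV[R]_n => w 0 k)) => //.
    exact: matrix_normedtype.coord_continuous.
  have ccont : {for s, continuous (coord j \o gam)}.
    exact: is_derive1_continuous (derivableP cd).
  have Gc (k l : 'I_n) : (fun t => gmx g j (coord j (gam t)) k l) @ s -->
      gmx g j (coord j (gam s)) k l.
    apply: (@continuous_comp _ _ _ (coord j \o gam) (fun w => gmx g j w k l)) => //.
    have [+ _] := gmx_smooth g j k l 0; apply; exact: img_coord.
  apply: cvg_sumr => k; apply: cvg_sumr => l; apply: cvgM => //.
  by apply: cvgM.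
have e20 : 0 < e / 2 by rewrite divr_gt0.
(* The margin e/2 puts [a] and [b] in the interior of the interval while staying inside the range of
   continuity. *)
have [t /andP[? ?]|L HL] := @primitive_itv R (speed g gam) (a - e / 2) (b + e / 2).
  by apply: sc; apply/andP; split; lra.
have Lab s : a <= s <= b -> is_derive s 1 L (speed g gam s).
  by move=> /andP[? ?]; apply: HL; apply/andP; split; lra.
exists L; split.
  apply: Rintegral_primitive => // s /andP[? ?]; apply: sc.
  by apply/andP; split; lra.
move=> s sab; have [|gc Hs] := H s; first by case/andP: sab => ? ?; apply/andP; split; lra.
by split => //; [move=> i /Hs[]|exact: Lab].
Unshelve. all: by end_near. Qed.

End curves.

(** * Curves in a calibrated coordinate ball *)

Section calibrated_paths.
Variables (R : realType) (n : nat) (M : topologicalType) (A : smooth_atlas R n M).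
Variables (g : riemannian_metric A) (i : chart A) (x0 : 'rV[R]_n) (d r m : R).
Variable F : R -> 'rV[R]_n -> R.
Implicit Types (x y : M) (gam : R -> M).
Hypothesis hM : hausdorff_space M.
Hypotheses (m0 : 0 < m).
Hypothesis rI : forall z, `|z - x0| < r -> img i z /\
  forall u, m * `|u| <= Num.sqrt (bil (gmx g i z) u u).
Hypothesis FP : forall (tau : R -> R) (zeta : R -> 'rV[R]_n) (s t' : R) u,
  is_derive s 1 tau t' -> is_derive s 1 zeta u ->
  0 <= tau s -> tau s < d -> `|zeta s - x0| < r ->
  exists2 D, is_derive s 1 (fun s => F (tau s) (zeta s)) D &
    (t' = Num.sqrt (bil (gmx g i (zeta s)) u u) -> D <= 0) /\
    (t' = 1 -> u = 0 -> D < 0).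

(** The image of a compact ball is compact, hence closed in the Hausdorff space M. This prevents a
    curve from leaving the chart domain while its coordinates stay in the ball. *)
Lemma chart_ball_closed (rho : R) : rho < r ->
  closed [set x | dom i x /\ `|coord i x - x0| <= rho].
Proof.
move=> rr; pose C := [set z : 'rV[R]_n | `|z - x0| <= rho].
rewrite (_ : [set x | _] = inv_coord i @` C); last first.
  apply/seteqP; split => [x [ix xr]|_ [z zr <-]].
    by exists (coord i x) => //; rewrite coordK.
  have [iz _] := rI (le_lt_trans zr rr).
  by split; [exact: dom_inv_coord|rewrite inv_coordK].
apply: compact_closed => //; apply: continuous_compact.
  apply: continuous_in_subspaceT => z; rewrite inE => zr.
  by apply: inv_coord_continuous; have [] := rI (le_lt_trans zr rr).
apply: bounded_closed_compact.
  exists (rho + `|x0|); split; first exact: num_real.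
  move=> y ry z zr; apply: le_trans (ltW ry).
  by rewrite -(subrK x0 z) (le_trans (ler_normD _ _))// lerD2r.
rewrite (_ : C = closed_ball_ Num.norm x0 rho); first exact: closed_closed_ball_.
by apply/seteqP; split => z; rewrite /C/closed_ball_/= distrC.
Qed.

Section C1_piece.
Variables (gam : R -> M) (a b : R) (L : R -> R).
Hypothesis gamL : forall s, a <= s <= b -> [/\ {for s, continuous gam},
  forall j : chart A, dom j (gam s) -> derivable (coord j \o gam) s 1 &
  is_derive s 1 L (speed g gam s)].

Let inside t := dom i (gam t) /\ `|coord i (gam t) - x0| < r.

Let velocity s : a <= s <= b -> inside s -> exists u,
  [/\ is_derive s 1 (coord i \o gam) u,
      speed g gam s = Num.sqrt (bil (gmx g i (coord i (gam s))) u u) &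
      m * `|u| <= speed g gam s].
Proof.
move=> sab [is_ sr]; have [gc /(_ i is_) cd Ld] := gamL sab.
have cd' := derivableP cd; exists ('D_1 (coord i \o gam) s).
have E := speed_chart g gc is_ cd'.
by split; [exact: cd'|exact: E|rewrite E; exact: (rI sr).2].
Qed.

(** As [m * |u|] is at most the speed, each coordinate, with either sign [c], grows no faster than
    [L / m]. *)
Lemma C1_displacement t : a <= t <= b -> (forall s, a <= s <= t -> inside s) ->
  `|coord i (gam t) - coord i (gam a)| <= (L t - L a) / m.
Proof.
move=> /andP[at_ tb] ins.
have sab s : a <= s <= t -> a <= s <= b.
  by move=> /andP[-> st]; rewrite (le_trans st).
have key (k : 'I_n) (c : R) : `|c| = 1 ->
    c * coord i (gam t) 0 k - L t / m <= c * coord i (gam a) 0 k - L a / m.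
  move=> c1.
  have dP s : a <= s <= t -> exists2 D : R,
      is_derive s 1 (fun s => c * coord i (gam s) 0 k - L s / m) D & D <= 0.
    move=> st; have [u [ud su mu]] := velocity (sab s st) (ins s st).
    have [_ _ Ld] := gamL (sab s st).
    exists (c * u 0 k - m^-1 * speed g gam s).
      rewrite (_ : (fun s => _) = (fun s => c * coord i (gam s) 0 k - m^-1 * L s)); last first.
        by apply/funext => q; rewrite (mulrC _^-1).
      apply: is_deriveB; apply: is_deriveZ => //.
      exact: (is_derive_coord k ud).
    rewrite subr_le0 (le_trans (ler_norm _))// normrM c1 mul1r.
    rewrite (le_trans (coord_le_norm _ _))// mulrC ler_pdivlMr// mulrC//.
  apply: (@nonincreasing_derive _ (fun s => c * coord i (gam s) 0 k - L s / m)
    ('D_1 (fun s => c * coord i (gam s) 0 k - L s / m)) a t at_).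
    by move=> s /dP[D [Dd DE] _]; split.
  by move=> s /dP[D [_ ->]].
have Lm : 0 <= (L t - L a) / m.
  rewrite divr_ge0 ?(ltW m0)// subr_ge0 -lerN2.
  apply: (@nonincreasing_derive _ (fun s => - L s) (fun s => - speed g gam s) a t at_).
    by move=> s /sab/gamL[_ _ Ld]; exact: is_deriveN.
  by move=> s _; rewrite oppr_le0 sqrtr_ge0.
apply: rV_norm_le => // k; rewrite !mxE ler_norml mulrBl.
have := key k 1 (normr1 _); have := key k (-1) (normrN1 _).
by rewrite !mul1r !mulN1r => ? ?; apply/andP; split; lra.
Qed.

(** Continuity argument: consider the last time [T] up to which the curve stays in the closed ball
    of radius [rho], the largest that its length allows, and show that [T] is [b]. The derivative of
    [F] along the curve is then nonpositive throughout. *)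
Lemma C1_piece_calibrated (t0 : R) : a <= b -> 0 <= t0 -> t0 + (L b - L a) < d ->
  dom i (gam a) -> `|coord i (gam a) - x0| + (L b - L a) / m < r ->
  [/\ 0 <= L b - L a, dom i (gam b),
     `|coord i (gam b) - x0| <= `|coord i (gam a) - x0| + (L b - L a) / m &
     F (t0 + (L b - L a)) (coord i (gam b)) <= F t0 (coord i (gam a))].
Proof.
move=> ab t00 td ia ar.
have Lmono s t : a <= s -> s <= t -> t <= b -> L s <= L t.
  move=> as_ st tb; rewrite -lerN2.
  apply: (@nonincreasing_derive _ (fun s => - L s) (fun s => - speed g gam s) s t st).
    move=> q /andP[sq qt].
    have /gamL[_ _ Ld] : a <= q <= b by rewrite (le_trans as_)// (le_trans qt).
    exact: is_deriveN.
  by move=> q _; rewrite oppr_le0 sqrtr_ge0.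
have L0 : 0 <= L b - L a by rewrite subr_ge0 Lmono.
set rho := `|coord i (gam a) - x0| + (L b - L a) / m in ar *.
have bound t : a <= t <= b -> (forall s, a <= s <= t -> inside s) ->
    `|coord i (gam t) - x0| <= rho.
  move=> tab ins; have H := C1_displacement tab ins; case/andP: tab => at_ tb.
  have -> : coord i (gam t) - x0 = (coord i (gam a) - x0) + (coord i (gam t) - coord i (gam a)).
    by rewrite [RHS]addrC subrKA.
  rewrite (le_trans (ler_normD _ _))// lerD2l (le_trans H)//.
  by rewrite ler_pM2r ?invr_gt0// lerD2r Lmono.
pose In t := dom i (gam t) /\ `|coord i (gam t) - x0| <= rho.
have InI t : In t -> inside t by move=> [? tr]; split=> //; exact: le_lt_trans ar.
pose S := [set t | a <= t <= b /\ forall s, a <= s <= t -> In s].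
have Sa : S a.
  split; first by rewrite lexx.
  move=> s /le_anti <-; split => //; rewrite /rho lerDl divr_ge0// ltW//.
have hS : has_sup S by split; [exists a|exists b => t [/andP[]]].
pose T := sup S.
have aT : a <= T by apply: sup_ubound => //; exact: hS.2.
have Tb : T <= b by apply: ge_sup; [exact: hS.1|move=> t [/andP[]]].
have Tab : a <= T <= b by rewrite aT.
have [gcT _ _] := gamL Tab.
(* Otherwise, the closed ball having an open complement in M, times of [S] just before [T] would be
   outside. *)
have InT : In T.
  apply: contrapT => nIn.
  have : \forall s \near T, ~ In s.
    have : nbhs (gam T) (~` [set x | dom i x /\ `|coord i x - x0| <= rho]).
      by apply: open_nbhs_nbhs; split => //; exact/closed_openC/chart_ball_closed.
    exact: gcT.
  move=> /nbhs_ballP[e /= e0 H].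
  have [s Ss Ts] := sup_adherent e0 hS.
  have sT : s <= T by apply: sup_ubound => //; exact: hS.2.
  apply: (H s); last by case: Ss => /andP[as_ _]; apply; rewrite as_ lexx.
  by rewrite /ball/= ger0_norm ?subr_ge0// ltrBlDr addrC -ltrBlDr.
have ST : S T.
  split=> // s /andP[as_]; rewrite le_eqVlt => /predU1P[->//|sT].
  have e0 : 0 < T - s by rewrite subr_gt0.
  have [t [_ Ht] Ts] := sup_adherent e0 hS.
  by apply: Ht; rewrite as_/=; move: Ts; rewrite -/T subKr => /ltW.
(* Just after [T] the curve is still in the open ball of radius [r > rho]; the displacement bound
   holds there and improves [r] back to [rho], so [S] would go beyond [T]. *)
have TE : T = b.
  apply/eqP; rewrite eq_le Tb leNgt; apply/negP => Tltb.
  have [iT rT] := InI _ InT.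
  have : \forall s \near T, inside s.
    have [_ /(_ i iT) cd _] := gamL Tab.
    have cc := is_derive1_continuous (derivableP cd).
    have H1 := near_dom gcT iT.
    have : \forall s \near T, `|coord i (gam s) - x0| < r.
      have e1 : 0 < r - `|coord i (gam T) - x0| by rewrite subr_gt0.
      move/cvgrPdist_lt : cc => /(_ _ e1); apply: filterS => s.
      rewrite ltrBrDr distrC; apply: le_lt_trans.
      by rewrite -[in leLHS](subrKA (coord i (gam T))) ler_normD.
    by apply: filterS2 H1 => s ? ?; split.
  move=> /nbhs_ballP[e /= e0 H].
  pose q := Num.min b (T + e / 2).
  have e20 : 0 < e / 2 by rewrite divr_gt0.
  have Tq : T < q by rewrite lt_min Tltb ltrDl.
  have qb : q <= b by rewrite ge_min lexx.
  have qe : q <= T + e / 2 by rewrite ge_min lexx orbT.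
  have insq s : a <= s <= q -> inside s.
    move=> /andP[as_ sq]; have [sT|Ts] := leP s T.
      by apply: InI; apply: ST.2; rewrite as_.
    by apply: H; rewrite /ball/= ler0_norm ?subr_le0 ?ltW//; lra.
  have : S q.
    split; first by rewrite qb (le_trans aT) ?ltW.
    move=> s /andP[as_ sq]; have [is_ _] := insq s (introT andP (conj as_ sq)).
    split => //; apply: bound; first by rewrite as_ (le_trans sq).
    by move=> p /andP[ap ps]; apply: insq; rewrite ap (le_trans ps).
  by move=> /(sup_ubound hS.2); rewrite leNgt Tq.
rewrite TE in InT ST *.
split => //; [by case: InT|by case: InT|].
pose tau s := t0 + (L s - L a).
have ta : tau a = t0 by rewrite /tau subrr addr0.
rewrite -[X in _ <= F X _]ta -/(tau b).
have dP s : a <= s <= b -> exists2 D : R,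
    is_derive s 1 (fun s => F (tau s) (coord i (gam s))) D & D <= 0.
  move=> sab; have ins := InI _ (ST.2 s sab).
  have [u [ud su _]] := velocity sab ins.
  have [_ _ Ld] := gamL sab; case/andP: sab => as_ sb.
  have taud : is_derive s 1 tau (speed g gam s).
    rewrite -[speed _ _ _]add0r -[X in 0 + X]subr0.
    by apply: is_deriveD; apply: is_deriveB.
  have [|||D Dd [H _]] := FP taud ud; last by exists D => //; exact: H.
  - by rewrite addr_ge0// subr_ge0 Lmono.
  - by rewrite (le_lt_trans _ td)// lerD2l lerD2r Lmono.
  - by case: ins.
apply: (@nonincreasing_derive _ (fun s => F (tau s) (coord i (gam s)))
  ('D_1 (fun s => F (tau s) (coord i (gam s)))) a b ab).
  by move=> s /dP[D [Dd DE] _]; split.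
by move=> s /dP[D [_ ->]].
Qed.

End C1_piece.

Lemma path_length_ge0 x y l : path_length g x y l -> 0 <= l.
Proof.
elim=> [gam a b ab cg|? ? ? ? ? _ l0 _ k0]; last exact: addr_ge0.
by apply: Rintegral_ge0 => s _; exact: sqrtr_ge0.
Qed.

(** The starting time is arbitrary for the sake of concatenation: the clock of the second path
    starts where that of the first stops. *)
Lemma path_calibrated x y l : path_length g x y l -> forall t0,
  0 <= t0 -> t0 + l < d -> dom i x -> `|coord i x - x0| + l / m < r ->
  [/\ dom i y, `|coord i y - x0| <= `|coord i x - x0| + l / m &
      F (t0 + l) (coord i y) <= F t0 (coord i x)].
Proof.
elim=> [gam a b ab cg|{}x {}y z k l1 xy IHx yz IHy] t0 t00 td ix xr.
  have [L [EL HL]] := C1_curve_speed g ab cg.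
  rewrite EL in td xr *.
  by have [] := C1_piece_calibrated HL ab t00 td ix xr.
have k0 := path_length_ge0 xy; have l0 := path_length_ge0 yz.
rewrite mulrDl addrA in xr; rewrite addrA in td.
have l0m : 0 <= l1 / m by rewrite divr_ge0// ltW.
have td1 : t0 + k < d by apply: le_lt_trans td; rewrite lerDl.
have xr1 : `|coord i x - x0| + k / m < r by apply: le_lt_trans xr; rewrite lerDl.
have [iy yr Fy] := IHx t0 t00 td1 ix xr1.
have yr1 : `|coord i y - x0| + l1 / m < r by apply: le_lt_trans xr; rewrite lerD2r.
have [iz zr Fz] := IHy (t0 + k) (addr_ge0 t00 k0) td iy yr1.
split => //.
- by rewrite (le_trans zr)// mulrDl addrA lerD2r.
- by rewrite addrA (le_trans Fz).
Qed.

End calibrated_paths.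

(** * Minimal geodesics and functions monotone along them *)

Section minimal_geodesics.
Variables (R : realType) (n : nat) (M : topologicalType) (A : smooth_atlas R n M).
Variable g : riemannian_metric A.
Implicit Types (i j : chart A) (x y z w : 'rV[R]_n) (gam : R -> M) (u : M -> R).

Lemma near_ball_itv (d t : R) : `|t| < d -> \forall s \near t, `|s| < d.
Proof.
move=> td; have e0 : 0 < d - `|t| by rewrite subr_gt0.
have /cvgrPdist_lt /(_ _ e0) : {for t, continuous (fun s : R => `|s|)} by exact: norm_continuous.
by apply: filterS => s; rewrite ltr_norml => /andP[? ?]; lra.
Qed.

(** One chart controls all competing paths: one that is shorter than [s0] cannot leave the
    coordinate ball where the calibration lives. *)
Lemma minimal_geodesic_exists i x (v0 : 'rV[R]_n) : hausdorff_space M ->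
  img i x -> bil (gmx g i x) v0 v0 = 1 ->
  exists gam s0, [/\ 0 < s0, minimal_geodesic g gam s0, gam 0 = inv_coord i x &
    is_derive (0 : R) 1 (coord i \o gam) v0].
Proof.
move=> hM ix v1.
have [c [v [d [r [m [F [[d0 r0 m0] [c0 v0E] cv rI FP]]]]]]] := calibration ix v1.
pose gam t := inv_coord i (c t).
have gd t : `|t| < d -> dom i (gam t).
  by move=> /cv[ct _ _ _ _]; exact: dom_inv_coord.
have gK t : `|t| < d -> coord i (gam t) = c t.
  by move=> /cv[ct _ _ _ _]; exact: inv_coordK.
have gc t : `|t| < d -> {for t, continuous gam}.
  move=> td; have [ct cd _ _ _] := cv t td.
  apply: continuous_comp; first exact: is_derive1_continuous cd.
  exact: inv_coord_continuous.
have gD (t : R) : `|t| < d -> is_derive t 1 (coord i \o gam) (v t).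
  move=> td; have [_ cd _ _ _] := cv t td.
  apply: near_eq_is_derive cd.
  by apply: filterS (near_ball_itv td) => s /gK.
have gcN (t : R) : `|t| < d -> \forall s \near t, {for s, continuous gam}.
  by move=> td; apply: filterS (near_ball_itv td) => s; exact: gc.
have gDN (t : R) : `|t| < d -> \forall s \near t, is_derive (s : R) 1 (coord i \o gam) (v s).
  by move=> td; apply: filterS (near_ball_itv td) => s; exact: gD.
have gN (t : R) : `|t| < d -> speed g gam t = 1.
  move=> td; rewrite (speed_chart g (gc t td) (gd t td) (gD t td)) gK//.
  by have [_ _ _ -> _] := cv t td; rewrite sqrtr1.
have gfield (t : R) : `|t| < d ->
    is_derive t 1 v (geodesic_field g i (coord i (gam t)) (v t)).
  by move=> td; rewrite gK//; have [] := cv t td.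
have gG (t : R) j (td : `|t| < d) (jt : dom j (gam t)) :=
  geodesic_chart (gcN t td) (gd t td) jt (gDN t td) (gfield t td).
(* [s0 + s0 <= d] leaves room for extending the curve by [s0] past both ends; [s0 < r * m] bounds
   the displacement of shorter paths by [r]. *)
pose s0 := Num.min d (r * m) / 2.
have rm0 : 0 < r * m by rewrite mulr_gt0.
have s00 : 0 < s0 by rewrite divr_gt0// lt_min d0.
have [s0d s0r] : s0 + s0 <= d /\ s0 < r * m.
  split; first by rewrite /s0 -splitr ge_min lexx.
  by rewrite /s0 ltr_pdivrMr// gt_min; apply/orP; right; lra.
have itvd s : 0 - s0 < s < s0 + s0 -> `|s| < d.
  by move=> /andP[? ?]; rewrite ltr_norml; apply/andP; split; lra.
have itvd' s : 0 <= s <= s0 -> `|s| < d.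
  by move=> /andP[? ?]; apply: itvd; apply/andP; split; lra.
have len : curve_length g gam 0 s0 = s0.
  rewrite -[RHS]subr0; apply: (@Rintegral_primitive _ _ id); first exact: ltW.
    move=> t /itvd' td; apply: (@near_eq_continuous R R (fun=> 1)).
      by apply: filterS (near_ball_itv td) => s /gN ->.
    exact: cvg_cst.
  by move=> t /itvd' td; rewrite gN//; exact: is_derive_id.
have d00 : `|0 : R| < d by rewrite normr0.
have s0dd : `|s0| < d by apply: itvd'; rewrite lexx ltW.
have C1c : C1_curve A gam 0 s0.
  exists s0; first exact: s00.
  move=> s /itvd sd; split; first exact: gc.
  move=> j js; have [cd cdd _] := gG s j sd js; split; first exact: cd.
  exact: is_derive1_continuous (derivableP cdd).
have path0 : path_length g (gam 0) (gam s0) s0.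
  by rewrite -[X in path_length _ _ _ X]len; apply: path_length_C1; [exact: ltW|].
have dist : riemannian_dist g (gam 0) (gam s0) = s0.
  apply/eqP; rewrite eq_le; apply/andP; split.
    apply: ge_inf; last exact: path0.
    by exists 0 => l /= /path_length_ge0.
  apply: lb_le_inf; first by exists s0; exact: path0.
  move=> l /= pl; rewrite leNgt; apply/negP => ls0.
  have l0 := path_length_ge0 pl.
  have ld : 0 + l < d by rewrite add0r (lt_le_trans ls0)//; lra.
  have xr : `|coord i (gam 0) - x| + l / m < r.
    rewrite gK// c0 subrr normr0 add0r ltr_pdivrMr//; exact: lt_trans s0r.
  have [_ _] := path_calibrated hM m0 rI FP pl (lexx 0) ld (gd 0 d00) xr.
  rewrite !gK// add0r.
  have [_ _ _ _ [_ ->]] := cv 0 d00.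
  have [_ _ _ _ [s0x Fs0]] := cv s0 s0dd.
  have dP t : l <= t <= s0 -> exists2 D : R,
      is_derive t 1 (fun t => F t (c s0)) D & D < 0.
    move=> /andP[lt ts].
    have [||D Dd [_ D0]] := FP id (cst (c s0)) t 1 0
      (is_derive_id _ _) (is_derive_cst _ _ _) _ _ s0x.
    - exact: le_trans lt.
    - by rewrite (le_lt_trans ts)//; lra.
    - by exists D => //; exact: D0.
  have [|t tl E] := @MVT_le _ (fun t => F t (c s0)) ('D_1 (fun t => F t (c s0))) l s0 (ltW ls0).
    by move=> t /dP[D [Dd _] _]; split.
  have [D [_ DE] D0] := dP t tl.
  rewrite leNgt => /negP; apply.
  move: E; rewrite Fs0 sub0r DE => E.
  by rewrite -oppr_lt0 E nmulr_rlt0// subr_gt0.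
exists gam, s0; split; [exact: s00| |by rewrite /gam c0|by rewrite -v0E; exact: gD].
split; [exact: ltW| |by rewrite len dist].
exists s0; [exact: s00|move=> s /itvd sd; split; first exact: gc].
by move=> j js; exact: (gG s j sd js).
Qed.

Lemma derive_le0_at_right (f : R -> R) (D s0 : R) : is_derive (0 : R) 1 f D ->
  0 < s0 -> (forall t, 0 <= t <= s0 -> f t <= f 0) -> D <= 0.
Proof.
move=> [fd <-] s00 fs; rewrite leNgt; apply/negP => D0.
have /cvgrPdist_lt /(_ _ D0) := fd.
rewrite near_withinE => /nbhs_ballP[e /= e0 H].
pose h := Num.min s0 (e / 2).
have e20 : 0 < e / 2 by rewrite divr_gt0.
have h0 : 0 < h by rewrite lt_min s00.
have he : h < e by rewrite gt_min; apply/orP; right; rewrite ltr_pdivrMr// ltr_pMr// ltr1n.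
have hs : h <= s0 by rewrite ge_min lexx.
have := H h; rewrite /ball/= sub0r normrN gtr0_norm// => /(_ he).
rewrite gt_eqF// => /(_ isT).
rewrite -[h%:A]/(h * 1) mulr1 addr0.
set q := h^-1 *: _ => qD.
have q0 : q <= 0.
  rewrite /q -[_ *: _]/(h^-1 * _) mulr_ge0_le0 ?invr_ge0 ?(ltW h0)// subr_le0.
  by apply: fs; rewrite (ltW h0).
have := le_lt_trans (ler_norm _) qD.
by rewrite ltrBlDr ltrDl ltNge q0.
Qed.

Lemma smooth_fun_C1 u i : smooth_fun A u -> Ck_on 1 (img i) (u \o inv_coord i).
Proof. by move=> us; exact: us. Qed.

(** Minimal geodesics leave the point in the two opposite directions of the coordinate vector, so
    the derivative, times the nonzero value of [u], is both nonpositive and nonnegative. *)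
Lemma nonincreasing_partial u i x (a : 'I_n) : hausdorff_space M -> smooth_fun A u ->
  (forall gam s0, minimal_geodesic g gam s0 -> forall s r, 0 <= s -> s <= r -> r <= s0 ->
    u (gam 0) * u (gam r) <= u (gam 0) * u (gam s)) ->
  img i x -> u (inv_coord i x) != 0 -> partial a (u \o inv_coord i) x = 0.
Proof.
move=> hM us H ix ux0.
pose P w := \sum_b partial b (u \o inv_coord i) x * w 0 b.
have key w : bil (gmx g i x) w w = 1 -> u (inv_coord i x) * P w <= 0.
  move=> w1; have [gam [s0 [s00 mg g0 gd]]] := minimal_geodesic_exists hM ix w1.
  have [_ [e e0 /(_ 0) He] _] := mg.
  have gc : {for 0, continuous gam}.
    by apply: (fun E => (He E).1); apply/andP; split; lra.
  have dg : dom i (gam 0) by rewrite g0; exact: dom_inv_coord.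
  have cx : coord i (gam 0) = x by rewrite g0 inv_coordK.
  have ud : is_derive (0 : R) 1 (u \o gam) (P w).
    have ic : img i ((coord i \o gam) 0) by rewrite /= cx.
    have := C1_chain (@img_openE _ _ _ A i) ic (smooth_fun_C1 i us) gd.
    rewrite /= cx; apply: near_eq_is_derive.
    by apply: filterS (near_dom gc dg) => t it /=; rewrite coordK.
  have ud' := is_deriveZ (u (gam 0)) ud.
  rewrite -g0; apply: (@derive_le0_at_right (fun t => u (gam 0) * u (gam t)) _ s0 ud' s00).
  move=> t /andP[t0 ts].
  exact: (H gam s0 mg 0 t).
pose e : 'rV[R]_n := delta_mx 0 a.
have e0 : e != 0.
  by apply/eqP => /rowP /(_ a); rewrite !mxE !eqxx => /eqP; rewrite oner_eq0.
have q0 := gmx_pos g ix e0; rewrite -/(bil _ _ _) in q0.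
pose k := (Num.sqrt (bil (gmx g i x) e e))^-1.
have k0 : 0 < k by rewrite invr_gt0 sqrtr_gt0.
have k1 (s : R) : s ^+ 2 = 1 -> bil (gmx g i x) ((s * k) *: e) ((s * k) *: e) = 1.
  move=> s1; rewrite bilZl bilZr mulrA -expr2 exprMn s1 mul1r.
  by rewrite /k exprVn sqr_sqrtr ?ltW// mulVf// gt_eqF.
have PE (s : R) : P ((s * k) *: e) = s * k * partial a (u \o inv_coord i) x.
  rewrite /P (bigD1 a)//= big1 ?addr0 => [|b ba].
    by rewrite !mxE !eqxx mulr1 mulrC.
  by rewrite !mxE (negbTE ba) andbF !mulr0.
have H1 := key _ (k1 1 (expr1n _ _)).
have H2 := key _ (k1 (-1) (etrans (sqrrN 1) (expr1n _ 2))).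
rewrite !PE in H1 H2.
have : u (inv_coord i x) * (k * partial a (u \o inv_coord i) x) = 0.
  apply/eqP; rewrite eq_le; apply/andP; split; first by move: H1; rewrite mul1r.
  by move: H2; rewrite !mulN1r !mulNr mulrN oppr_le0.
by move/eqP; rewrite !mulf_eq0 (negbTE ux0) (gt_eqF k0)/= => /eqP.
Qed.

Lemma smooth_fun_continuous u : smooth_fun A u -> continuous u.
Proof.
move=> us p; pose i := chart_at A p.
have ip : dom i p by exact: dom_chart_at.
have [wc _] := us i 0%N.
apply: (@near_eq_continuous _ _ ((u \o inv_coord i) \o coord i)).
  have : \forall q \near p, dom i q by apply: open_nbhs_nbhs; split; [exact: dom_open|].
  by apply: filterS => q iq /=; rewrite coordK.
apply: continuous_comp; first exact: coord_continuous.
by apply: wc; exact: img_coord.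
Qed.

Lemma nonincreasing_const u : hausdorff_space M -> connected [set: M] -> smooth_fun A u ->
  (forall gam s0, minimal_geodesic g gam s0 -> forall s r, 0 <= s -> s <= r -> r <= s0 ->
    u (gam 0) * u (gam r) <= u (gam 0) * u (gam s)) ->
  exists k, forall p, u p = k.
Proof.
move=> hM cM us H.
have [[p0 up0]|u0] := pselect (exists p, u p != 0); last first.
  by exists 0 => p; apply/eqP; apply: contrapT => /negP up; apply: u0; exists p.
exists (u p0).
have uc := smooth_fun_continuous us.
pose B := [set p | u p = u p0].
suff : B = [set: M] by move=> BT p; have : [set: M] p by []; rewrite -BT.
apply: cM; first by exists p0.
- exists B; last by rewrite setTI.
  rewrite openE => p Bp; rewrite /interior.
  pose i := chart_at A p.
  have ip : dom i p by exact: dom_chart_at.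
  have ic := img_coord ip.
  have [wc _] := us i 0%N.
  have [r1 r10 Hr1] := open_ball_sub (@img_openE _ _ _ A i) ic.
  have : \forall z \near coord i p, (u \o inv_coord i) z != 0.
    have : nbhs ((u \o inv_coord i) (coord i p)) [set y : R | y != 0].
      by apply: open_nbhs_nbhs; split; [exact: open_neq|rewrite /= coordK// Bp].
    exact: wc.
  move=> /nbhs_normP[r2 /= r20 Hr2].
  pose r := Num.min r1 r2.
  have near_r : \forall q \near p, dom i q /\ `|coord i q - coord i p| < r.
    have H1 : \forall q \near p, dom i q by apply: open_nbhs_nbhs; split; [exact: dom_open|].
    have : \forall z \near coord i p, `|z - coord i p| < r.
      apply/nbhs_normP; exists r; first by rewrite /= lt_min r10.
      by move=> z; rewrite /ball_/= distrC.
    move/(coord_continuous ip) => H2.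
    by apply: filterS2 H1 H2.
  apply: filterS near_r => q [iq qr]; rewrite /B/= -Bp.
  have -> : u q = (u \o inv_coord i) (coord i q) by rewrite /= coordK.
  have -> : u p = (u \o inv_coord i) (coord i p) by rewrite /= coordK.
  apply/eqP; rewrite -subr_eq0 -normr_le0.
  (* The bound is 0: on the box between the two points [u] does not vanish, so its partial
     derivatives do. *)
  rewrite (le_trans (@dist_le_partial _ _ _ (coord i p) (coord i q) 0 _)) ?mul0r// => w a bw.
  have : `|w - coord i p| < r.
    by apply: between_ball bw => //; rewrite subrr normr0 lt_min r10.
  rewrite lt_min => /andP[w1 w2].
  have iw : img i w by exact: Hr1.
  have [_ /(_ a)[fd _]] := smooth_fun_C1 i us.
  split; first exact: fd.
  rewrite (nonincreasing_partial a hM us H iw) ?normr0//.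
  by apply: Hr2; rewrite /ball_/= distrC.
- exists B; last by rewrite setTI.
  rewrite (_ : B = u @^-1` [set y | y = u p0])//.
  by apply: (@closed_comp _ _ u) => [p _|]; [exact: uc|exact: closed_eq].
Qed.

End minimal_geodesics.

(** * Heat kernel asymptotics *)

Section spectrum.
Variables (R : realType) (n : nat) (M : ptopologicalType) (A : smooth_atlas R n M).
Variables (g : riemannian_metric A) (mu : {measure set (borel M) -> \bar R}).
Variables (lam : nat -> R) (phi : nat -> M -> R).
Implicit Types (u w : M -> R).

Lemma inner_eq0 w : (forall p, w p = 0) -> inner mu w w = 0.
Proof.
move=> w0; rewrite /inner (@eq_Rintegral _ _ _ mu _ (cst 0)); last first.
  by move=> p _; rewrite /= w0 mulr0.
by rewrite /Rintegral/= integral0.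
Qed.

(** If the two eigenvalues agreed, [phi 1] and [phi 2] would lie on one line of eigenfunctions,
    against orthonormality. *)
Lemma simple_lam_lt : spectral_resolution g mu lam phi ->
  simple_eigenvalue g (lam 1%N) -> lam 1%N < lam 2%N.
Proof.
move=> [_ _ lamS eig [L2 ortho _]] [u [_ _ Hu]].
rewrite lt_neqAle lamS// andbT; apply/eqP => E.
have [c1 H1] := Hu _ (eig 1%N).
have [|c2 H2] := Hu (phi 2%N); first by rewrite E; exact: eig.
have nz j : ~ (forall p, phi j p = 0).
  by move=> /inner_eq0; rewrite ortho eqxx => /eqP; rewrite oner_eq0.
have c10 : c1 != 0.
  by apply/eqP => c10; apply: (nz 1%N) => p; rewrite H1 c10 mul0r.
have E2 p : phi 2%N p = c2 / c1 * phi 1%N p.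
  by rewrite H2 H1 mulrA divfK.
have : inner mu (phi 1%N) (phi 2%N) = c2 / c1 * inner mu (phi 1%N) (phi 1%N).
  rewrite /inner -RintegralZl//.
    by apply: eq_Rintegral => p _; rewrite E2 mulrCA.
  by apply/Lfun1_integrable/Lfun2_mul_Lfun1; exact: L2.
rewrite !ortho/= mulr1 => /esym c0.
by apply: (nz 2%N) => p; rewrite E2 c0 mul0r.
Qed.

Lemma laplace_beltrami_cst i (k : R) x : laplace_beltrami g i (fun=> k) x = 0.
Proof.
have dk (b : 'I_n) (l : R) y : partial b (fun=> l) y = 0 by exact: derive_cst.
rewrite /laplace_beltrami big1 ?mulr0// => a _.
rewrite (_ : (fun y => _) = fun=> 0) ?dk//.
apply/funext => y; rewrite big1 ?mulr0// => b _.
by rewrite dk mulr0.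
Qed.

(** The Laplacian kills constants, so a constant eigenfunction of a positive eigenvalue is 0 and
    cannot have norm 1. *)
Lemma eigenfunction_not_cst j k : spectral_resolution g mu lam phi ->
  0 < lam j -> ~ (forall p, phi j p = k).
Proof.
move=> [_ _ _ eig [_ ortho _]] lj pk.
pose p0 : M := point; pose i := chart_at A p0.
have ip : dom i p0 by exact: dom_chart_at.
have [_ /(_ i _ (img_coord ip))] := eig j.
rewrite (_ : phi j \o inv_coord i = fun=> k); last by apply/funext => z /=.
rewrite laplace_beltrami_cst oppr0 pk => /esym /eqP.
rewrite mulf_eq0 gt_eqF//= => /eqP k0.
have : inner mu (phi j) (phi j) = 0 by apply: inner_eq0 => p; rewrite pk.
by rewrite ortho eqxx => /eqP; rewrite oner_eq0.
Qed.

End spectrum.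

Lemma expR_small (R : realType) (d C e : R) : 0 < d -> 0 <= C -> 0 < e ->
  exists2 T : R, 0 < T & forall t, T <= t -> expR (- d * t) * C <= e.
Proof.
move=> d0 C0 e0.
(* This time comes from [expR x >= 1 + x]: beyond it, [e * expR (d * t)] is at least
   [e * d * t >= C + 1]. *)
have T0 : 0 < (C + 1) / (d * e) by rewrite divr_gt0 ?ltr_wpDl// mulr_gt0.
exists ((C + 1) / (d * e)) => // t Tt.
have t0 : 0 < t by exact: lt_le_trans Tt.
rewrite mulNr expRN mulrC ler_pdivrMr ?expR_gt0//.
have : C + 1 <= t * (d * e) by rewrite -ler_pdivrMr// mulr_gt0.
have := expR_ge1Dx (d * t).
by move: (expR _) => X H1 H2; nra.
Qed.

Section heat_kernel.
Variables (R : realType) (M : Type) (lam : nat -> R) (phi : nat -> M -> R).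
Variable K : R -> M -> M -> R.
Hypothesis lamS : forall j k, (j <= k)%N -> lam j <= lam k.
Hypothesis HK : is_heat_kernel lam phi K.

Let term t x y j := expR (- lam j * t) * phi j x * phi j y.

Let cvgK t x y : 0 < t -> (fun N => \sum_(j < N) term t x y j) @ \oo --> K t x y.
Proof. exact: HK. Qed.

Let diag_le x N : \sum_(j < N) term 1 x x j <= K 1 x x.
Proof.
have cK := @cvgK 1 x x ltr01.
rewrite -(cvg_lim _ cK)//; apply: (nondecreasing_cvgn_le _ (cvgP _ cK)).
apply/nondecreasing_seqP => k; rewrite big_ord_recr/= lerDl.
by rewrite /term -mulrA mulr_ge0 ?expR_ge0// -expr2 sqr_ge0.
Qed.

(** Pointwise convergence at time 1 on the diagonal, where all terms are nonnegative, gives absolute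
    summability at time 1; for t >= 1 every term of index at least N gains the factor
    [expR (- lam N * (t - 1))]. *)
Lemma heat_kernel_tail x y : exists2 C : R, 0 <= C & forall N t, 1 <= t ->
  `|K t x y - \sum_(j < N) term t x y j| <= expR (- lam N * (t - 1)) * C.
Proof.
(* From |ab| <= (a^2 + b^2) / 2, term by term. *)
pose C := 2^-1 * (K 1 x x + K 1 y y).
have abs_le n : \sum_(j < n) (expR (- lam j) * `|phi j x * phi j y|) <= C.
  rewrite /C (le_trans _ (ler_wpM2l _ (lerD (diag_le x n) (diag_le y n))))// ?invr_ge0//.
  rewrite -big_split/= mulr_sumr; apply: ler_sum => j _; rewrite /term mulr1 -!mulrA -mulrDr.
  rewrite mulrCA ler_wpM2l ?expR_ge0// normrM.
  have := sqr_ge0 (`|phi j x| - `|phi j y|).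
  rewrite -!expr2 -(real_normK (num_real (phi j x))) -(real_normK (num_real (phi j y))).
  move: (`|phi j x|) (`|phi j y|) => a b H; nra.
have C0 : 0 <= C by have := abs_le 0%N; rewrite big_ord0.
exists C => // N t t1.
have part k : `|\sum_(j < N + k) term t x y j - \sum_(j < N) term t x y j| <=
    expR (- lam N * (t - 1)) * C.
  rewrite big_split_ord/= addrAC subrr add0r (le_trans (ler_norm_sum _ _ _))//.
  apply: (@le_trans _ _ (expR (- lam N * (t - 1)) *
     \sum_(j < k) (expR (- lam (N + j)%N) * `|phi (N + j)%N x * phi (N + j)%N y|))).
    rewrite mulr_sumr; apply: ler_sum => j _.
    rewrite /term -mulrA normrM ger0_norm ?expR_ge0// mulrA -expRD ler_wpM2r//.
    rewrite ler_expR; have := lamS (leq_addr j N).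
    by move: (lam _) (lam _) => a b ba; nra.
  rewrite ler_wpM2l ?expR_ge0// (le_trans _ (abs_le (N + k)%N))//.
  rewrite big_split_ord/= lerDr; apply: sumr_ge0 => j _.
  by rewrite mulr_ge0 ?expR_ge0.
have t0 : 0 < t by rewrite (lt_le_trans ltr01).
have cK := @cvgK t x y t0.
have : (fun k => `|\sum_(j < N + k) term t x y j - \sum_(j < N) term t x y j|) @ \oo -->
    `|K t x y - \sum_(j < N) term t x y j|.
  apply: cvg_norm; apply: cvgB; last exact: cvg_cst.
  have := cK; rewrite -(cvg_shiftn N) /=; apply: cvg_trans; apply: near_eq_cvg.
  by apply: nearW => k; rewrite addnC.
move=> cv; rewrite -(cvg_lim _ cv)//.
by apply: limr_le; [exact: cvgP cv|exact: nearW].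
Qed.

(** The terms below N cancel; after division by [expR (- lam N * t)] the tails are of order
    [expR (- (lam N.+1 - lam N) * t)]. With the three points fixed, arbitrarily large times
    suffice. *)
Lemma leading_term_le N x y z : lam N < lam N.+1 ->
  (forall T, 0 < T -> exists2 t, T <= t & K t x y <= K t x z) ->
  (forall j, (j < N)%N -> phi j x * phi j y = phi j x * phi j z) ->
  phi N x * phi N y <= phi N x * phi N z.
Proof.
move=> lamN often low.
have [C C0 HC] := heat_kernel_tail x y; have [C' C'0 HC'] := heat_kernel_tail x z.
apply/ler_addgt0Pr => e e0.
have dl : 0 < lam N.+1 - lam N by rewrite subr_gt0.
have D0 : 0 <= expR (lam N.+1) * (C + C') by rewrite mulr_ge0 ?expR_ge0 ?addr_ge0.
have [T T0 HT] := expR_small dl D0 e0.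
have [|t] := often (Num.max T 1); first by rewrite lt_max T0.
rewrite ge_max => /andP[Tt t1] Kle.
have := HC N.+1 t t1; have := HC' N.+1 t t1; rewrite !big_ord_recr/=.
have -> : \sum_(j < N) term t x y j = \sum_(j < N) term t x z j.
  by apply: eq_bigr => j _; rewrite /term -!mulrA low.
rewrite !ler_norml => /andP[_ H1] /andP[H2 _].
have H3 : expR (- lam N * t) * (phi N x * phi N y - phi N x * phi N z) <=
    expR (- lam N.+1 * (t - 1)) * (C + C').
  rewrite mulrBr !mulrA mulrDr; move: H1 H2 Kle; rewrite /term.
  move: (\sum_(j < N) _) (K t x y) (K t x z) => S ky kz; lra.
rewrite -lerBlDl (le_trans _ (HT t Tt))//.
have E : expR (- lam N.+1 * (t - 1)) * (C + C') =
    expR (- lam N * t) * (expR (- (lam N.+1 - lam N) * t) * (expR (lam N.+1) * (C + C'))).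
  by rewrite !mulrA -!expRD; congr (expR _ * _); ring.
by move: H3; rewrite E ler_pM2l ?expR_gt0.
Qed.

End heat_kernel.

Theorem theorem2p2 (R : realType) (n : nat) (M : ptopologicalType)
    (A : smooth_atlas R n M) (g : riemannian_metric A)
    (mu : {measure set (borel M) -> \bar R})
    (lam : nat -> R) (phi : nat -> M -> R) (K : R -> M -> M -> R) :
  hausdorff_space M -> compact [set: M] -> connected [set: M] ->
  is_riemannian_volume g mu ->
  spectral_resolution g mu lam phi ->
  simple_eigenvalue g (lam 1%N) ->
  is_heat_kernel lam phi K ->
  exists2 T : R, 0 < T &
    forall t : R, T <= t -> ~ geodesically_decreasing g (K t).
Proof.
move=> hM _ cM _ sr simple hk.
have lam12 := simple_lam_lt sr simple.
have [lam0 lam1 lamS eig _] := sr.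
apply: contrapT => never.
have often T : 0 < T -> exists2 t, T <= t & geodesically_decreasing g (K t).
  move=> T0; apply: contrapT => none; apply: never; exists T => // t Tt gd.
  by apply: none; exists t.
(* Applied to N = 0, where the gap is [0 < lam 1], then to N = 1, where the gap is simplicity and
   the constant [phi 0] supplies the cancellation. *)
have phi_const N : lam N < lam N.+1 ->
    (forall j, (j < N)%N -> exists k, forall p, phi j p = k) ->
    exists k, forall p, phi N p = k.
  move=> lamN low; apply: (nonincreasing_const (g := g) hM cM); first by have [] := eig N.
  move=> gam s0 mg s r s_ge0 sr' rs0; apply: (leading_term_le lamS hk lamN).
    move=> T /often[t Tt gd]; exists t => //.
    exact: (gd (gam 0) gam s0).
  by move=> j /low[k pk]; rewrite !pk.
have [k0 phi0] : exists k, forall p, phi 0%N p = k.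
  by apply: phi_const => //; rewrite lam0.
have [k1 phi1] : exists k, forall p, phi 1%N p = k.
  by apply: phi_const => // j; rewrite ltnS leqn0 => /eqP ->; exists k0.
exact: (eigenfunction_not_cst sr lam1 phi1).
Qed.
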